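(* Let $M=\mathbb{C}^n/(\mathbb{Z}^n+\mathrm{i}\mathbb{Z}^n)$ and let $\xi$ be a fixed Higgs tensor. Then the real moment map equation $$\left(-\tfrac{1}{2}G^{ab}+(\check{\alpha}\,\xi\, G\,\bar{\xi})^{ab}\right)_{,ab}=0,\qquad G=D^2u,$$ is the Euler–Lagrange equation, with respect to variations of the symplectic potential $u$ in $\mathscr{A}(\xi)$, for the periodic HK-energy $$\widehat{\mathcal{F}}(u,\xi)=-\frac12\int_{\mathbb{T}}\log\det(D^2u)\,\mathrm{d}\mu+\frac12\int_{\mathbb{T}}H(u,\xi)\,\mathrm{d}\mu .$$
   Context: $\mathbb{T}=\mathbb{R}^n/\mathbb{Z}^n$ with coordinates $\boldsymbol y$ and Lebesgue measure $\mathrm{d}\mu$. A symplectic potential is a function $u(\boldsymbol y)=\frac12|\boldsymbol y|^2+(\text{a smooth }\mathbb{Z}^n\text{-periodic function})$ with positive definite Hessian $G=D^2u$; $(G^{ab})=G^{-1}$. Variations of $u$ are by smooth periodic functions. A Higgs tensor $\xi$ is a smooth function on $\mathbb{T}$ with values in complex symmetric $n\times n$ matrices. $\xi G\bar\xi G$ has real non-negative eigenvalues $\delta(1),\dots,\delta(n)$, and $$H(u,\xi)=\sum_{i=1}^n\Big(1-\sqrt{1-\delta(i)}+\log\tfrac{1+\sqrt{1-\delta(i)}}2\Big).$$ $\mathscr{A}(\xi)$ is the set of symplectic potentials $u$ such that the spectral radius of $\xi G\bar\xi G$ is $<1$ everywhere. $\check\alpha=\psi(\xi G\bar\xi G)$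 with $\psi(x)=\frac12(1+\sqrt{1-x})^{-1}$. Subscripts after a comma denote derivatives in $\boldsymbol y$; repeated indices are summed. *)

(* Defs.v *)
From HB Require Import structures.
From mathcomp Require Import all_boot all_order all_algebra complex.
From mathcomp Require Import all_classical all_reals all_analysis.

Set Implicit Arguments.
Unset Strict Implicit.
Unset Printing Implicit Defensive.

Import Order.TTheory GRing.Theory Num.Theory numFieldNormedType.Exports.

Local Open Scope classical_set_scope.
Local Open Scope ring_scope.

(* n-dimensional Lebesgue measure on n-tuples: iterated product of the
   one-dimensional one, transported along (x, t) |-> x :: t. *)
Section lebesgue_tuple.
Context {R : realType}.
Local Notation RT := (measurableTypeR R).

Section step.
Context (n : nat) (m : {sigma_finite_measure set (n.-tuple RT) -> \bar R}).

Definition tuple_cons (p : RT * n.-tuple RT) : n.+1.-tuple RT :=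
  [tuple of p.1 :: p.2].

Lemma measurable_tuple_cons : measurable_fun [set: RT * n.-tuple RT] tuple_cons.
Proof. exact: measurable_cons. Qed.

Definition lebesgue_tuple_step : set (n.+1.-tuple RT) -> \bar R :=
  pushforward (lebesgue_measure \x m)%E tuple_cons.

Let mu : {measure set (n.+1.-tuple RT) -> \bar R} :=
  measure_function_pushforward__canonical__measure_function_Measure
    (lebesgue_measure \x m)%E measurable_tuple_cons.

HB.instance Definition _ := isMeasure.Build _ _ _ lebesgue_tuple_step
  (measure0 mu) (measure_ge0 mu) (@measure_semi_sigma_additive _ _ _ mu).

Let lebesgue_tuple_step_sigma_finite : sigma_finite setT lebesgue_tuple_step.
Proof.
have [F UF mF] : sigma_finite setT (lebesgue_measure \x m)%E.
  have /sigma_finiteP[F [TF ndF Foo]] := sigma_finiteT (@lebesgue_measure R).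
  have /sigma_finiteP[G [TG ndG Goo]] := sigma_finiteT m.
  exists (fun k => F k `*` G k).
    rewrite -setXTT TF TG; apply/seteqP; split=> [[x t]|[x t] [k _ [? ?]]].
      move=> [[/= i _ Fx] [j _ Gt]]; exists (maxn i j) => //; split => /=.
        by move: x Fx; exact/subsetPset/ndF/leq_maxl.
      by move: t Gt; exact/subsetPset/ndG/leq_maxr.
    by split; exists k.
  move=> k; have [? ?] := Foo k; have [? ?] := Goo k.
  split; first exact: measurableX.
  by rewrite product_measure1E// lte_mul_pinfty// ge0_fin_numE.
pose g (t : n.+1.-tuple RT) : RT * n.-tuple RT :=
  (tnth t ord0, [tuple of behead t]).
have mg : measurable_fun setT g.
  by apply: measurable_fun_pair; [exact: measurable_tnth|exact: measurable_behead].
have consK : cancel tuple_cons g.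
  by move=> [x t]; congr pair; apply: val_inj.
exists (fun i => g @^-1` F i).
  by rewrite -preimage_bigcup -UF preimage_setT.
move=> i; split; first by rewrite -[X in measurable X]setTI; apply: mg => //; case: (mF i).
rewrite /lebesgue_tuple_step /pushforward -comp_preimage.
by rewrite (_ : g \o tuple_cons = id) ?preimage_id; [case: (mF i)|exact/funext].
Qed.

HB.instance Definition _ := Measure_isSigmaFinite.Build _ _ _
  lebesgue_tuple_step lebesgue_tuple_step_sigma_finite.
End step.

Fixpoint lebesgue_tuple n : {sigma_finite_measure set (n.-tuple RT) -> \bar R} :=
  match n with
  | 0 => dirac [tuple]
  | n'.+1 => lebesgue_tuple_step (lebesgue_tuple n')
  end.

Lemma lebesgue_tuple_box n (A : 'I_n -> set RT) :
  (forall i, measurable (A i)) ->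
  lebesgue_tuple n [set t | forall i, A i (tnth t i)] =
  (\big[mule/1%E]_(i < n) lebesgue_measure (A i)).
Proof.
elim: n A => [|n IHn] A mA.
  by rewrite big_ord0 /= diracE mem_set// => -[].
rewrite big_ord_recl -IHn //= /lebesgue_tuple_step /pushforward.
rewrite -product_measure1E//; last first.
  rewrite (_ : [set _ | _] =
      \bigcap_(i in [set: 'I_n]) ((fun t => tnth t i) @^-1` A (lift ord0 i))).
    apply: fin_bigcap_measurable => // i _.
    by rewrite -[X in measurable X]setTI; exact: measurable_tnth.
  by apply/seteqP; split => t /= tA i; [move=> _; exact: tA|exact: tA].
congr (_ _); apply/seteqP; split=> -[x t] /=.
  by move=> xt; split; [exact: (xt ord0)|move=> i; have := xt (lift ord0 i); rewrite tnthS].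
move=> [Ax At] i; case: (unliftP ord0 i) => [j ->|->//]; rewrite ?tnthS//.
Qed.
End lebesgue_tuple.

Section torus.
Context {R : realType} {n : nat}.
Implicit Types (f u v : 'rV[R]_n -> R) (y : 'rV[R]_n).

(* [0, 1]^n is a fundamental domain of R^n / Z^n up to a null set. *)
Definition unit_cube : set (n.-tuple (measurableTypeR R)) :=
  [set t | forall i, tnth t i \in `[0, 1]].

Definition torus_integral f : R :=
  \int[lebesgue_tuple n]_(t in unit_cube) f (\row_i tnth t i).

Definition partial (i : 'I_n) f : 'rV[R]_n -> R :=
  fun y => 'D_(delta_mx 0 i) f y.

(* All iterated partial derivatives exist and are continuous. *)
Definition smooth f : Prop :=
  forall s : seq 'I_n, continuous (foldr partial f s) /\
    forall i y, derivable (foldr partial f s) y (delta_mx 0 i).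

Definition periodic (T : Type) (f : 'rV[R]_n -> T) : Prop :=
  forall (k : 'rV[int]_n) y, f (y + map_mx intr k) = f y.

Definition smooth_periodic f : Prop := smooth f /\ periodic f.

Definition hessian u y : 'M[R]_n :=
  \matrix_(a, b) partial b (partial a u) y.

Definition posdefmx (M : 'M[R]_n) : Prop :=
  M^T = M /\ forall x : 'rV[R]_n, x != 0 -> 0 < (x *m M *m x^T) 0 0.

Definition symplectic_potential u : Prop :=
  (exists2 f, smooth_periodic f &
     forall y, u y = 2^-1 * (\sum_i y 0 i ^+ 2) + f y) /\
  forall y, posdefmx (hessian u y).

End torus.

Section matrix_functions.
Context {R : realType} {n : nat}.
Local Notation C := R[i].
Implicit Types M : 'M[C]_n.

(* The n eigenvalues, repeated according to algebraic multiplicity. *)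
Definition eigenvalues M : seq C :=
  sval (closed_field_poly_normal (char_poly M)).

Definition spectral_radius M : R :=
  \big[Num.max/0]_(z <- eigenvalues M) Normc.normc z.

(* Sylvester's formula for f(M), M diagonalisable with real spectrum: f is
   applied to the (real) eigenvalues, and the product over mu <> lambda is the
   projection onto the lambda-eigenspace along the other eigenspaces. *)
Definition matrix_fun (f : R -> R) M : 'M[C]_n :=
  \sum_(l <- undup (eigenvalues M)) (f (complex.Re l))%:C%C *:
    \big[mulmx/1%:M]_(m <- undup (eigenvalues M) | m != l)
      ((l - m)^-1 *: (M - m%:M)).

End matrix_functions.

Section HK_energy.
Context {R : realType} {n : nat}.
Local Notation C := R[i].
Implicit Types (u : 'rV[R]_n -> R) (xi : 'rV[R]_n -> 'M[C]_n) (y : 'rV[R]_n).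

Definition higgs_tensor xi : Prop :=
  [/\ periodic xi,
      forall y, (xi y)^T = xi y,
      forall a b, smooth (fun y => complex.Re (xi y a b)) &
      forall a b, smooth (fun y => complex.Im (xi y a b))].

Definition complexify (M : 'M[R]_n) : 'M[C]_n := map_mx (real_complex R) M.

(* xi G (conj xi) and xi G (conj xi) G, with G = D^2 u *)
Definition xiGxi u xi y : 'M[C]_n :=
  xi y *m complexify (hessian u y) *m map_mx conjc (xi y).

Definition xiGxiG u xi y : 'M[C]_n :=
  xiGxi u xi y *m complexify (hessian u y).

Definition admissible xi u : Prop :=
  symplectic_potential u /\ forall y, spectral_radius (xiGxiG u xi y) < 1.

(* The eigenvalues of xi G (conj xi) G are real: it is similar to the positive
   semidefinite Hermitian matrix X X^*, X = G^(1/2) xi G^(1/2). Taking real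
   parts hence only changes their type. *)
Definition HK_H u xi y : R :=
  \sum_(z <- eigenvalues (xiGxiG u xi y))
    let d := complex.Re z in
    1 - Num.sqrt (1 - d) + ln ((1 + Num.sqrt (1 - d)) / 2).

Definition HK_energy xi u : R :=
  - 2^-1 * torus_integral (fun y => ln (\det (hessian u y)))
  + 2^-1 * torus_integral (HK_H u xi).

Definition psi (x : R) : R := 2^-1 * (1 + Num.sqrt (1 - x))^-1.

Definition check_alpha u xi y : 'M[C]_n := matrix_fun psi (xiGxiG u xi y).

Definition moment_tensor u xi y : 'M[C]_n :=
  - 2^-1 *: complexify (invmx (hessian u y)) + check_alpha u xi y *m xiGxi u xi y.

Definition cpartial (i : 'I_n) (f : 'rV[R]_n -> C) : 'rV[R]_n -> C :=
  fun y => Complex (partial i (fun x => complex.Re (f x)) y)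
                   (partial i (fun x => complex.Im (f x)) y).

Definition real_moment_map_eq xi u : Prop :=
  forall y, \sum_a \sum_b
    cpartial b (cpartial a (fun x => moment_tensor u xi x a b)) y = 0.

End HK_energy.

Section variations.
Context {R : realType} {n : nat}.
Implicit Types (u v : 'rV[R]_n -> R) (F : ('rV[R]_n -> R) -> R).

Definition vary u v (t : R) : 'rV[R]_n -> R := fun y => u y + t * v y.

(* Gateaux derivative of F at u in the direction v. *)
Definition first_variation F u v : R := 'D_1 (fun t => F (vary u v t)) (0 : R).

Definition has_first_variation F u v : Prop :=
  derivable (fun t => F (vary u v t)) (0 : R) 1.

Definition critical_point F u : Prop :=
  forall v, smooth_periodic v ->
    has_first_variation F u v /\ first_variation F u v = 0.

End variations.

(* Main.v *)
(* With [P = G^(1/2)], [X = P xi P], [Q = (1 - X X^* )^(1/2)] and [S = P^-1 Q P]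
   one has [S^2 = 1 - A], [A = xi G conj(xi) G], so that
   [psi(A) = (1 + S)^-1 / 2] and [H = tr (1 - S) + ln det ((1 + S) / 2)].
   Differentiating [S^2 = 1 - A] gives a Sylvester equation for [S'], and with
   [S xi G = xi G conj(S)] the derivative of the energy density along [v] turns
   out to be [tr (Re T . D^2 v)], [T] being the moment tensor. Two integrations
   by parts rewrite the first variation as the integral of [v] against the
   double divergence of [Re T]; testing against [v] equal to that divergence
   gives the converse. The imaginary part of [T] is antisymmetric, so its double
   divergence vanishes.

   Regularity of the square roots comes from the invertibility of the Sylvester
   operator [X |-> A X + X B] for positive definite [A], [B]. Nearby potentials
   are admissible because spectral radius [< 1] amounts to positive definiteness
   of [G - G xi G conj(xi) G], an open condition on a compact torus. Hermitian
   matrices are handled through the real matrices [[Re, Im], [-Im, Re]]. *)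

Require Import Defs.
From mathcomp Require Import all_boot all_order all_algebra complex.
From mathcomp Require Import all_classical all_reals all_analysis.
From mathcomp Require Import measurable_realfun perm ring lra.
Import Order.TTheory GRing.Theory Num.Theory numFieldNormedType.Exports.

Set Implicit Arguments.
Unset Strict Implicit.
Unset Printing Implicit Defensive.

Local Open Scope classical_set_scope.
Local Open Scope ring_scope.

(** * Positive definite matrices and the Sylvester equation *)

(** Eigenvalues and their projections lose regularity where eigenvalues cross, so neither
    [matrix_fun] nor the sum over [eigenvalues] can be differentiated as written. Both are rewritten
    pointwise through [S], and the entries of [S] are followed by one argument: continuity,
    directional derivability and smoothness are each classes of real functions closed under ring
    operations, inverses and positive definite roots. [S] itself is in general not symmetric, only
    self-adjoint for [G], hence the detour through the two symmetric roots [P] and [Q]; the rest is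
    rational. Closure under roots is stated for families positive definite at every parameter,
    whereas a variation is admissible only for small [t]. The parameter is therefore truncated to a
    small interval before differentiating, and the result is carried back by local equality. The
    truncated family is continuous on the whole parameter space, so compactness also gives the bound
    that dominates the derivative under the integral. *)

Section posdef.
Context {R : realType}.
Implicit Types n m : nat.

Lemma trmx11 (M : 'M[R]_1) : M^T = M.
Proof. by rewrite [M]mx11_scalar tr_scalar_mx. Qed.

Lemma dotv_ge0 n (x : 'rV[R]_n) : 0 <= (x *m x^T) 0 0.
Proof. by rewrite mxE sumr_ge0// => i _; rewrite mxE -expr2 sqr_ge0. Qed.

Lemma dotv_eq0 n (x : 'rV[R]_n) : (x *m x^T) 0 0 = 0 -> x = 0.
Proof.
rewrite mxE => /eqP; rewrite psumr_eq0; last first.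
  by move=> i _; rewrite mxE -expr2 sqr_ge0.
move=> /allP x0; apply/rowP => i; rewrite mxE.
by have := x0 i; rewrite mem_index_enum mxE mulf_eq0 orbb => /(_ isT)/eqP.
Qed.

Lemma posdef_ge0 n (M : 'M[R]_n) (x : 'rV_n) : posdefmx M ->
  0 <= (x *m M *m x^T) 0 0.
Proof.
move=> [_ M0]; have [->|/M0/ltW//] := eqVneq x 0.
by rewrite !mul0mx mxE.
Qed.

Lemma posdef_unit n (M : 'M[R]_n) : posdefmx M -> M \in unitmx.
Proof.
move=> [_ M0]; rewrite -row_free_unit; apply: inj_row_free => x xM.
apply/eqP/negPn/negP => /M0; by rewrite xM mul0mx mxE ltxx.
Qed.

Lemma posdef_congr m n (M : 'M[R]_n) (U : 'M[R]_(m, n)) :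
  row_free U -> posdefmx M -> posdefmx (U *m M *m U^T).
Proof.
move=> uU [Ms M0]; split; first by rewrite !trmx_mul trmxK Ms mulmxA.
move=> x x0; have := M0 (x *m U); rewrite trmx_mul !mulmxA; apply.
by apply: contra x0 => /eqP xU; rewrite -(mulmx_free_eq0 _ uU) xU.
Qed.

Lemma posdef_congr_unit n (M U : 'M[R]_n) :
  U \in unitmx -> posdefmx (U *m M *m U^T) -> posdefmx M.
Proof.
move=> uU /(@posdef_congr _ _ _ (invmx U)).
rewrite row_free_unit unitmx_inv => /(_ uU).
by rewrite !mulmxA mulVmx// mul1mx -mulmxA -trmx_mul mulVmx// trmx1 mulmx1.
Qed.

Lemma posdef_diag n (e : 'rV[R]_n) :
  posdefmx (diag_mx e) <-> forall i, 0 < e 0 i.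
Proof.
have E x : (x *m diag_mx e *m x^T) 0 0 = \sum_i e 0 i * x 0 i ^+ 2.
  by rewrite mxE; apply: eq_bigr => i _; rewrite mul_mx_diag !mxE; ring.
split=> [[_ M0] i|e0].
  have := M0 (delta_mx 0 i); rewrite E (bigD1 i)//= mxE !eqxx expr1n mulr1.
  rewrite big1 ?addr0; last by move=> j ji; rewrite mxE eqxx (negPf ji) /= expr0n mulr0.
  apply; apply/eqP => /rowP/(_ i)/eqP; rewrite !mxE !eqxx/=; exact/negP/oner_neq0.
split; first by rewrite tr_diag_mx.
move=> x x0; rewrite E; have ge0 i : true -> 0 <= e 0 i * x 0 i ^+ 2.
  by move=> _; rewrite mulr_ge0 ?sqr_ge0// ltW.
rewrite lt_def sumr_ge0 // andbT psumr_eq0//.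
apply: contra x0 => /allP x0; apply/eqP/rowP => i; rewrite mxE.
have := x0 i; rewrite mem_index_enum mulf_eq0 sqrf_eq0 => /(_ isT).
by rewrite gt_eqF//= => /eqP.
Qed.

Lemma posdef_block n (M : 'M[R]_n) :
  posdefmx (block_mx M 0 0 M) <-> posdefmx M.
Proof.
have E (x y : 'rV_n) : (row_mx x y *m block_mx M 0 0 M *m (row_mx x y)^T) 0 0 =
    (x *m M *m x^T) 0 0 + (y *m M *m y^T) 0 0.
  by rewrite mul_row_block !mulmx0 addr0 add0r tr_row_mx mul_row_col mxE.
split=> -[Ms M0]; split.
- by move: Ms; rewrite tr_block_mx => /eq_block_mx[].
- move=> x x0; have := M0 (row_mx x 0); rewrite E !mul0mx [X in _ + X]mxE addr0; apply.
  by rewrite row_mx_eq0 negb_and x0.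
- by rewrite tr_block_mx Ms !trmx0.
- move=> z; rewrite -(hsubmxK z) row_mx_eq0 negb_and E => /orP[] z0.
    by rewrite ltr_pwDl ?M0// posdef_ge0.
  by rewrite ltr_wpDl ?M0// posdef_ge0.
Qed.

Lemma normM_le_sqr (a b : R) : `|a| * `|b| <= 2^-1 * (a ^+ 2 + b ^+ 2).
Proof.
rewrite -[a ^+ 2]real_normK ?num_real// -[b ^+ 2]real_normK ?num_real//.
have := sqr_ge0 (`|a| - `|b|); nra.
Qed.

(** Each term is at most [B (x_i^2 + x_j^2) / 2] in absolute value, and every square occurs [n]
    times in each of the two halves. *)
Lemma sum_mul_le n (x : 'rV[R]_n) (N : 'M[R]_n) (B : R) :
  (forall i j, `|N i j| <= B) -> `|(x *m N *m x^T) 0 0| <= n%:R * B * (x *m x^T) 0 0.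
Proof.
move=> NB.
have -> : (x *m N *m x^T) 0 0 = \sum_j \sum_i x 0 i * N i j * x 0 j.
  rewrite mxE; apply: eq_bigr => j _; rewrite !mxE mulr_suml.
  by apply: eq_bigr.
have xE : (x *m x^T) 0 0 = \sum_i x 0 i ^+ 2.
  by rewrite mxE; apply: eq_bigr => i _; rewrite mxE expr2.
have B0 (j : 'I_n) : 0 <= B by rewrite (le_trans _ (NB j j)).
apply: (le_trans (ler_norm_sum _ _ _)).
apply: (@le_trans _ _ (\sum_j \sum_i B * (2^-1 * (x 0 i ^+ 2 + x 0 j ^+ 2)))).
  apply: ler_sum => j _; apply: (le_trans (ler_norm_sum _ _ _)).
  apply: ler_sum => i _; rewrite !normrM mulrAC mulrC ler_pM//.
  exact: normM_le_sqr.
rewrite le_eqVlt; apply/orP; left; apply/eqP.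
under eq_bigr do rewrite -mulr_sumr -mulr_sumr big_split /= -xE sumr_const card_ord.
rewrite -mulr_sumr -mulr_sumr big_split /= sumr_const card_ord sumrMnl -xE.
have half (a : R) : 2^-1 * (a + a) = a by field.
by rewrite half -[X in B * X]mulr_natl mulrCA mulrA.
Qed.

(* Cauchy-Schwarz for the form [M], applied to [x] and [x M^-1]. *)
Lemma posdef_coercive n (M : 'M[R]_n) : posdefmx M ->
  exists2 c : R, 0 < c & forall x : 'rV_n, c * (x *m x^T) 0 0 <= (x *m M *m x^T) 0 0.
Proof.
move=> pM; have uM := posdef_unit pM; have [Ms M0] := pM.
pose B := 1 + \sum_i \sum_j `|invmx M i j|.
have B0 : 0 < B by rewrite ltr_pwDl// sumr_ge0// => i _; rewrite sumr_ge0.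
have NB i j : `|invmx M i j| <= B.
  rewrite /B ler_wpDl// (bigD1 i)//= (bigD1 j)//= -addrA lerDl.
  by rewrite addr_ge0// sumr_ge0// => k _; rewrite sumr_ge0.
(* [B] bounds the entries of [M^-1], hence [n.+1 * B] bounds its quadratic form; [n.+1] instead of
   [n] keeps the constant positive in dimension 0. *)
exists (n.+1%:R * B)^-1; first by rewrite invr_gt0 mulr_gt0// ltr0n.
move=> x; rewrite ler_pdivrMl; last by rewrite mulr_gt0// ltr0n.
pose z := x *m invmx M.
have zM : z *m M = x by rewrite mulmxKV.
set b := (x *m x^T) 0 0; set a := (x *m M *m x^T) 0 0.
pose d := (z *m M *m z^T) 0 0.
have b0 : 0 <= b by exact: dotv_ge0.
have zx : (x *m M *m z^T) = x *m x^T.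
  by rewrite -mulmxA -{1}Ms -trmx_mul zM.
have H s : 0 <= a + 2 * s * b + s ^+ 2 * d.
  have := @posdef_ge0 _ _ (x + s *: z) pM.
  have -> : (x + s *: z) *m M *m (x + s *: z)^T =
      x *m M *m x^T + s *: (x *m x^T) + s *: (x *m x^T) + s *: (s *: (z *m M *m z^T)).
    rewrite [(x + _)^T]linearD/= linearZ/= !mulmxDl !mulmxDr.
    by rewrite -!scalemxAl -!scalemxAr zx zM !addrA.
  have D (K L : 'M[R]_1) : (K + L) 0 0 = K 0 0 + L 0 0 by rewrite mxE.
  have Z k (K : 'M[R]_1) : (k *: K) 0 0 = k * K 0 0 by rewrite mxE.
  by rewrite !D !Z -/a -/b -/d; congr (0 <= _); ring.
have db : d <= n.+1%:R * B * b.
  have := sum_mul_le x NB; rewrite -/b.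
  have -> : x *m invmx M *m x^T = z *m M *m z^T.
    by rewrite zM -[LHS]trmx11 trmx_mul trmxK.
  rewrite -/d => /(le_trans (ler_norm _))/le_trans; apply.
  rewrite ler_wpM2r// ler_wpM2r ?(ltW B0)// ler_nat.
  exact: leqnSn.
have nB : 0 < n.+1%:R * B by rewrite mulr_gt0.
(* With [k = n.+1 * B] and [s = - k^-1], the inequality [a - 2 b / k + d / k^2 >= 0] and [d <= k b]
   give [b <= k a]. *)
have := H (- (n.+1%:R * B)^-1).
set k := n.+1%:R * B in db nB *.
have kk : k * k^-1 = 1 by rewrite divff// gt_eqF.
have k0 : 0 < k^-1 by rewrite invr_gt0.
move=> h.
have : k * (a - 2 * k^-1 * b + k^-1 ^+ 2 * d) >= 0.
  by rewrite mulr_ge0 ?(ltW nB)//; move: h; congr (0 <= _); ring.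
have -> : k * (a - 2 * k^-1 * b + k^-1 ^+ 2 * d) =
  k * a - 2 * (k * k^-1) * b + (k * k^-1) * (k^-1 * d) by ring.
rewrite kk.
have : k^-1 * d <= b by rewrite ler_pdivrMl.
lra.
Qed.

Lemma mxtrace_mul_rows m n (X : 'M[R]_(m, n)) (F : 'M[R]_n) :
  \tr (X *m F *m X^T) = \sum_i (row i X *m F *m (row i X)^T) 0 0.
Proof.
apply: eq_bigr => i _; rewrite -row_mul [LHS]mxE [RHS]mxE; apply: eq_bigr => j _.
by rewrite !mxE.
Qed.

Lemma mxtrace_coercive m n (X : 'M[R]_(m, n)) (F : 'M[R]_n) (c : R) :
  (forall x : 'rV_n, c * (x *m x^T) 0 0 <= (x *m F *m x^T) 0 0) ->
  c * \tr (X *m X^T) <= \tr (X *m F *m X^T).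
Proof.
move=> cF; rewrite -[X in _ * \tr (X *m _)]mulmx1 !mxtrace_mul_rows mulr_sumr.
by apply: ler_sum => i _; rewrite mulmx1.
Qed.

Lemma mxtrace_sqr m n (X : 'M[R]_(m, n)) :
  \tr (X *m X^T) = \sum_i \sum_j X i j ^+ 2.
Proof.
apply: eq_bigr => i _; rewrite mxE; apply: eq_bigr => j _.
by rewrite mxE expr2.
Qed.

Lemma mxtrace_sqr_ge0 m n (X : 'M[R]_(m, n)) : 0 <= \tr (X *m X^T).
Proof. by rewrite mxtrace_sqr; do 2!rewrite sumr_ge0// => *; rewrite sqr_ge0. Qed.

Lemma mxtrace_sqr_ge m n (X : 'M[R]_(m, n)) i j : X i j ^+ 2 <= \tr (X *m X^T).
Proof.
rewrite mxtrace_sqr (bigD1 i)//= (bigD1 j)//= -addrA lerDl addr_ge0//.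
  by rewrite sumr_ge0// => *; rewrite sqr_ge0.
by do 2!rewrite sumr_ge0// => *; rewrite sqr_ge0.
Qed.

(* Pairing a solution [X] of the Sylvester equation with itself. *)
Lemma sylvester_le n (A B X N : 'M[R]_n) (c : R) : 0 < c ->
  posdefmx A ->
  (forall x : 'rV_n, c * (x *m x^T) 0 0 <= (x *m B *m x^T) 0 0) ->
  A *m X + X *m B = N ->
  \tr (X *m X^T) <= c^-2 * \tr (N *m N^T).
Proof.
move=> c0 pA cB XN.
have h1 : \tr (X *m B *m X^T) <= \tr (N *m X^T).
  rewrite -XN mulmxDl mxtraceD lerDr -mulmxA mxtrace_mulC -mulmxA mxtrace_mulC.
  rewrite -[X in _ *m X]trmxK mxtrace_mul_rows sumr_ge0// => i _.
  exact: posdef_ge0.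
have h2 := mxtrace_coercive X cB.
(* Expansion of the square norm of [c X - N]. Together with [h1] and [h2] it absorbs half of the
   left-hand side. *)
have h3 : 2 * c * \tr (N *m X^T) <= c ^+ 2 * \tr (X *m X^T) + \tr (N *m N^T).
  have := mxtrace_sqr_ge0 (c *: X - N).
  rewrite linearB /= linearZ /= !mulmxBl !mulmxBr -!scalemxAl -!scalemxAr.
  rewrite !linearB /= !linearZ/= -[\tr (X *m N^T)]mxtrace_tr trmx_mul trmxK.
  rewrite expr2 /GRing.scale/=; lra.
rewrite -ler_pdivrMl ?invr_gt0 ?exprn_gt0// invrK.
have : c * (c * \tr (X *m X^T)) <= c * \tr (N *m X^T).
  by rewrite ler_pM2l// (le_trans h2 h1).
by rewrite expr2 in h3 *; lra.
Qed.

Lemma sylvester_inj n (A B X : 'M[R]_n) : posdefmx A -> posdefmx B ->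
  A *m X + X *m B = 0 -> X = 0.
Proof.
move=> pA /posdef_coercive[c c0 cB] X0.
have := sylvester_le c0 pA cB X0; rewrite mul0mx linear0 mulr0 => tX.
apply/matrixP => i j; rewrite mxE; apply/eqP; rewrite -sqrf_eq0 eq_le sqr_ge0 andbT.
exact: (le_trans (mxtrace_sqr_ge _ _ _)).
Qed.

(** The difference of the two roots solves the homogeneous Sylvester equation with coefficients [F]
    and [F']. *)
Lemma posdef_sqr_inj n (F F' : 'M[R]_n) : posdefmx F -> posdefmx F' ->
  F *m F = F' *m F' -> F = F'.
Proof.
move=> pF pF' FF; apply/subr0_eq/(sylvester_inj pF pF').
by rewrite mulmxBr mulmxBl FF addrA subrK subrr.
Qed.

(** The operator [X |-> A X + X B] on vectorised matrices, acting on row vectors. As a matrix it can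
    be inverted by [invmx], so that solutions are visibly rational in the entries of [A], [B] and
    the right-hand side. *)
Definition sylvester n (A B : 'M[R]_n) : 'M[R]_(n * n) :=
  \matrix_i mxvec (A *m vec_mx (delta_mx 0 i) + vec_mx (delta_mx 0 i) *m B).

Lemma mul_vec_sylvester n (A B X : 'M[R]_n) :
  mxvec X *m sylvester A B = mxvec (A *m X + X *m B).
Proof.
rewrite [LHS]mulmx_sum_row.
under eq_bigr do rewrite rowK -linearZ/= linearD/= scalemxAr scalemxAl.
rewrite -raddf_sum/= big_split/= -mulmx_suml -mulmx_sumr.
have <- : X = \sum_i mxvec X 0 i *: vec_mx (delta_mx 0 i).
  rewrite -{1}[X]mxvecK {1}(row_sum_delta (mxvec X)) linear_sum/=.
  by apply: eq_bigr => i _; rewrite linearZ.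
by [].
Qed.

Lemma sylvester_unit n (A B : 'M[R]_n) : posdefmx A -> posdefmx B ->
  sylvester A B \in unitmx.
Proof.
move=> pA pB; rewrite -row_free_unit; apply: inj_row_free => x.
rewrite -[x]vec_mxK mul_vec_sylvester => /(canRL mxvecK); rewrite linear0.
by move=> /(sylvester_inj pA pB) ->; rewrite linear0.
Qed.

End posdef.

(** * Function algebras closed under matrix square roots *)

Section function_algebra.
Context {R : realType} {T : Type}.
Implicit Types (K : (T -> R) -> Prop) (m n p : nat).

(* Used for the continuous functions, the functions differentiable at a given
   point along a given vector, and the smooth functions. *)
Definition function_algebra K : Prop :=
  [/\ forall c : R, K (fun=> c),
      forall f g, K f -> K g -> K (fun x => f x + g x),
      forall f g, K f -> K g -> K (fun x => f x * g x) &
      forall f, (forall x, f x != 0) -> K f -> K (fun x => (f x)^-1)].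

Definition entries_in K m n (F : T -> 'M[R]_(m, n)) : Prop :=
  forall i j, K (fun x => F x i j).

(** Positive definiteness singles out one root of [M x] and makes the Sylvester operator with
    coefficients [F x], [F y] invertible for all pairs of points. *)
Definition sqrt_closed K : Prop :=
  forall m (F M : T -> 'M[R]_m), (forall x, posdefmx (F x)) ->
    (forall x, F x *m F x = M x) -> entries_in K M -> entries_in K F.

Variable K : (T -> R) -> Prop.
Hypothesis algK : function_algebra K.

Lemma alg_cst c : K (fun=> c). Proof. by case: algK. Qed.
Lemma algD f g : K f -> K g -> K (fun x => f x + g x). Proof. by case: algK => ? + ? ?; exact. Qed.
Lemma algM f g : K f -> K g -> K (fun x => f x * g x). Proof. by case: algK => ? ? + ?; exact. Qed.
Lemma algV f : (forall x, f x != 0) -> K f -> K (fun x => (f x)^-1).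
Proof. by case: algK => ? ? ? +; exact. Qed.
Lemma algN f : K f -> K (fun x => - f x).
Proof.
move=> Kf; rewrite (_ : (fun _ => _) = (fun x => -1 * f x)); last first.
  by apply/funext => x; rewrite mulN1r.
by apply: algM => //; exact: alg_cst.
Qed.

Lemma alg_sum I (r : seq I) (P : pred I) (f : I -> T -> R) :
  (forall i, K (f i)) -> K (fun x => \sum_(i <- r | P i) f i x).
Proof.
move=> Kf; elim: r => [|i r IH].
  by rewrite (_ : (fun _ => _) = (fun=> 0)); [exact: alg_cst|apply/funext => x; rewrite big_nil].
case Pi : (P i).
  rewrite (_ : (fun _ => _) = (fun x => f i x + \sum_(i <- r | P i) f i x)).
    exact: algD.
  by apply/funext => x; rewrite big_cons Pi.
by under eq_fun do rewrite big_cons Pi.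
Qed.

Lemma alg_prod I (r : seq I) (P : pred I) (f : I -> T -> R) :
  (forall i, K (f i)) -> K (fun x => \prod_(i <- r | P i) f i x).
Proof.
move=> Kf; elim: r => [|i r IH].
  by rewrite (_ : (fun _ => _) = (fun=> 1)); [exact: alg_cst|apply/funext => x; rewrite big_nil].
case Pi : (P i).
  rewrite (_ : (fun _ => _) = (fun x => f i x * \prod_(i <- r | P i) f i x)).
    exact: algM.
  by apply/funext => x; rewrite big_cons Pi.
by under eq_fun do rewrite big_cons Pi.
Qed.

Lemma entries_cst m n (A : 'M[R]_(m, n)) : entries_in K (fun=> A).
Proof. by move=> i j; exact: alg_cst. Qed.

Lemma entriesD m n (F G : T -> 'M[R]_(m, n)) :
  entries_in K F -> entries_in K G -> entries_in K (fun x => F x + G x).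
Proof. by move=> KF KG i j; under eq_fun do rewrite mxE; exact: algD. Qed.

Lemma entriesN m n (F : T -> 'M[R]_(m, n)) :
  entries_in K F -> entries_in K (fun x => - F x).
Proof. by move=> KF i j; under eq_fun do rewrite mxE; exact: algN. Qed.

Lemma entriesB m n (F G : T -> 'M[R]_(m, n)) :
  entries_in K F -> entries_in K G -> entries_in K (fun x => F x - G x).
Proof. by move=> KF KG; apply: entriesD => //; exact: entriesN. Qed.

Lemma entriesZ m n (f : T -> R) (F : T -> 'M[R]_(m, n)) :
  K f -> entries_in K F -> entries_in K (fun x => f x *: F x).
Proof. by move=> Kf KF i j; under eq_fun do rewrite mxE; exact: algM. Qed.

Lemma entriesM m n p (F : T -> 'M[R]_(m, n)) (G : T -> 'M[R]_(n, p)) :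
  entries_in K F -> entries_in K G -> entries_in K (fun x => F x *m G x).
Proof.
move=> KF KG i j; under eq_fun do rewrite mxE.
by apply: alg_sum => k; exact: algM.
Qed.

Lemma entries_tr m n (F : T -> 'M[R]_(m, n)) :
  entries_in K F -> entries_in K (fun x => (F x)^T).
Proof. by move=> KF i j; under eq_fun do rewrite mxE; exact: KF. Qed.

Lemma entries_block m n p q (A : T -> 'M[R]_(m, n)) (B : T -> 'M[R]_(m, q))
    (C : T -> 'M[R]_(p, n)) (D : T -> 'M[R]_(p, q)) :
  entries_in K A -> entries_in K B -> entries_in K C -> entries_in K D ->
  entries_in K (fun x => block_mx (A x) (B x) (C x) (D x)).
Proof.
move=> KA KB KC KD i j.
by case: (split_ordP i) (split_ordP j) => i' -> [] j' ->; under eq_fun do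
  rewrite ?(block_mxEul, block_mxEur, block_mxEdl, block_mxEdr); first
  [exact: KA | exact: KB | exact: KC | exact: KD].
Qed.

Lemma alg_trace m (F : T -> 'M[R]_m) : entries_in K F -> K (fun x => \tr (F x)).
Proof. by move=> KF; apply: alg_sum => i. Qed.

Lemma alg_det m (F : T -> 'M[R]_m) : entries_in K F -> K (fun x => \det (F x)).
Proof.
move=> KF; apply: alg_sum => s; apply: algM; first exact: alg_cst.
by apply: alg_prod => i.
Qed.

Lemma entries_inv m (F : T -> 'M[R]_m) : (forall x, F x \in unitmx) ->
  entries_in K F -> entries_in K (fun x => invmx (F x)).
Proof.
move=> uF KF; rewrite (_ : (fun _ => _) = fun x => (\det (F x))^-1 *: \adj (F x)).
  apply: entriesZ.
    apply: algV; last exact: alg_det.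
    by move=> x; have := uF x; rewrite unitmxE unitfE.
  move=> i j; under eq_fun do rewrite mxE; apply: algM; first exact: alg_cst.
  by apply: alg_det => i' j'; under eq_fun do rewrite !mxE; exact: KF.
by apply/funext => x; rewrite /invmx uF.
Qed.

Lemma entries_sylvester m (A B : T -> 'M[R]_m) :
  entries_in K A -> entries_in K B ->
  entries_in K (fun x => sylvester (A x) (B x)).
Proof.
move=> KA KB i j; under eq_fun do rewrite mxE; case/mxvec_indexP: j => k l.
under eq_fun do rewrite mxvecE; set E := vec_mx _.
have : entries_in K (fun x => A x *m E + E *m B x); last exact.
by apply: entriesD; apply: entriesM => //; exact: entries_cst.
Qed.

Lemma entries_vec_mx m n (F : T -> 'rV[R]_(m * n)) :
  entries_in K F -> entries_in K (fun x => vec_mx (F x)).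
Proof. by move=> KF i j; under eq_fun do rewrite mxE; exact: KF. Qed.

Lemma entries_mxvec m n (F : T -> 'M[R]_(m, n)) :
  entries_in K F -> entries_in K (fun x => mxvec (F x)).
Proof.
move=> KF i j; rewrite (ord1 i); case/mxvec_indexP: j => k l.
by under eq_fun do rewrite mxvecE; exact: KF.
Qed.

End function_algebra.

Section continuous_algebra.
Context {R : realType} {T : topologicalType}.

Lemma continuous_algebra : function_algebra (fun f : T -> R => continuous f).
Proof.
split=> [c|f g cf cg|f g cf cg|f f0 cf] x.
- exact: cvg_cst.
- by apply: continuousD; [exact: cf|exact: cg].
- by apply: continuousM; [exact: cf|exact: cg].
- by apply: continuousV; [exact: f0|exact: cf].
Qed.

(** [F p - F p0] solves the Sylvester equation with coefficients [F p], [F p0] and right-hand side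
    [M p - M p0]. The estimate uses the coercivity constant of [F p0] only, so no lower bound on
    [F p] uniform in [p] is required. *)
Lemma continuous_sqrt_closed : sqrt_closed (fun f : T -> R => continuous f).
Proof.
move=> m F M pF FM cM i j p0.
have [c c0 cF] := posdef_coercive (pF p0).
pose N p := M p - M p0; pose tau p := \tr (N p *m (N p)^T).
have cN : entries_in (fun f : T -> R => continuous f) N.
  by apply: (entriesB continuous_algebra) => //; exact: (entries_cst continuous_algebra).
have ctau : continuous tau.
  apply: (alg_trace continuous_algebra (F := fun p => N p *m (N p)^T)).
  exact: (entriesM continuous_algebra cN (entries_tr cN)).
have tau0 : tau p0 = 0 by rewrite /tau /N subrr mul0mx linear0.
have Ftau p : (F p i j - F p0 i j) ^+ 2 <= c^-2 * tau p.
  have := mxtrace_sqr_ge (F p - F p0) i j; rewrite !mxE => /le_trans; apply.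
  apply: (sylvester_le c0 (pF p) cF).
  by rewrite mulmxBr mulmxBl !FM addrA subrK.
apply/cvgrPdist_lt => e e0.
have d0 : 0 < (c * e) ^+ 2 by rewrite exprn_gt0// mulr_gt0.
have := cvgr_lt _ (ctau p0) ((c * e) ^+ 2); rewrite tau0 => /(_ _ d0).
apply: filterS => p taup; rewrite distrC.
rewrite -(@ltr_pXn2r _ 2) ?nnegrE// ?(ltW e0)// real_normK ?num_real//.
apply: le_lt_trans (Ftau p) _.
by rewrite mulrC ltr_pdivrMr ?exprn_gt0// mulrC -exprMn.
Qed.

End continuous_algebra.

(** * Directional derivatives of matrix-valued functions *)

Section derivative.
Context {R : realType} {V : normedModType R}.
Implicit Types (a v : V).

Definition derivemx v m n (F : V -> 'M[R]_(m, n)) (a : V) : 'M[R]_(m, n) :=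
  \matrix_(i, j) 'D_v (fun x => F x i j) a.

(** Continuity is bundled in because differentiating a root passes to the limit in a Sylvester
    operator one of whose coefficients is the root at a moving point. *)
Definition derivable_at v a (f : V -> R) : Prop := continuous f /\ derivable f a v.

Lemma derivable_at_algebra v a : function_algebra (derivable_at v a).
Proof.
have [cc cD cM cV] := @continuous_algebra R V.
split=> [c|f g [cf df] [cg dg]|f g [cf df] [cg dg]|f f0 [cf df]]; split.
- exact: cc. - exact: derivable_cst.
- exact: cD. - exact: derivableD.
- exact: cM. - exact: (derivableM df dg).
- exact: cV. - exact: derivableV.
Qed.

(** The difference quotient of [F] is that of [M] multiplied by the inverse of [L h], the Sylvester
    operator with coefficients [F (h v + a)] and [F a]. This inverse is continuous in [h], so the
    quotient converges. *)
Lemma derivable_at_sqrt_closed v a : sqrt_closed (derivable_at v a).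
Proof.
move=> m F M pF FM dM.
have cM : entries_in (fun f : V -> R => continuous f) M by move=> i j; case: (dM i j).
have cF := continuous_sqrt_closed pF FM cM.
move=> i j; split; first exact: cF.
pose L h := sylvester (F (h *: v + a)) (F a).
have uL h : L h \in unitmx by exact: sylvester_unit.
have cL : entries_in (fun f : R -> R => continuous f) (fun h => invmx (L h)).
  apply: (entries_inv continuous_algebra) => //.
  apply: (entries_sylvester continuous_algebra); last exact: (entries_cst continuous_algebra).
  move=> k l h; apply: (@continuous_comp _ _ _ (fun h : R => h *: v + a) (fun x => F x k l)).
    apply: continuousD; last exact: cst_continuous.
    exact: scalel_continuous.
  exact: cF.
pose DQ (G : V -> 'M[R]_m) h := h^-1 *: (G (h *: v + a) - G a).
have DF h : mxvec (DQ F h) = mxvec (DQ M h) *m invmx (L h).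
  rewrite -[LHS](mulmxK (uL h)) mul_vec_sylvester; congr (mxvec _ *m _).
  rewrite /DQ -scalemxAr -scalemxAl -scalerDr; congr (_ *: _).
  by rewrite mulmxBr mulmxBl !FM addrA subrK.
rewrite /derivable.
rewrite (_ : (fun _ => _) = fun h : R => \sum_k mxvec (DQ M h) 0 k * invmx (L h) k (mxvec_index i j)).
  apply/cvg_ex.
  exists (\sum_k lim (mxvec (DQ M h) 0 k @[h --> (0 : R)^']) * invmx (L 0) k (mxvec_index i j)).
  apply: cvg_big => [|k _]; first exact: add_continuous.
  apply: cvgM.
    have [k' [l ->]] : exists k' l, k = mxvec_index k' l.
      by case/mxvec_indexP: k => k' l; exists k', l.
    have DM : (fun h => mxvec (DQ M h) 0 (mxvec_index k' l)) =
        (fun h => h^-1 *: (((fun x => M x k' l) \o shift a) (h *: v) - M a k' l)).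
      by apply/funext => h; rewrite mxvecE 3!mxE.
    have dM' := (dM k' l).2; rewrite /derivable -DM in dM'; exact: dM'.
  by apply: cvg_trans (cL _ _ 0); apply: cvg_app; exact: nbhs_dnbhs.
apply/funext => h /=; have := congr1 (fun A : 'rV_(m * m) => A 0 (mxvec_index i j)) (DF h).
by rewrite mxvecE [RHS]mxE => <-; rewrite !mxE.
Qed.
End derivative.

Section derivative_rules.
Context {R : realType} {V : normedModType R}.
Variables (v a : V).

Local Notation derivable_entries F := (entries_in (fun f : V -> R => derivable f a v) F).

Lemma is_derive_mul (f g : V -> R) : derivable f a v -> derivable g a v ->
  is_derive a v (fun x => f x * g x) ('D_v f a * g a + f a * 'D_v g a).
Proof.
move=> df dg; split; first exact: (derivableM df dg).
by rewrite (deriveM df dg) addrC mulrC.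
Qed.

Lemma is_derive_cmul (c : R) (f : V -> R) df : is_derive a v f df ->
  is_derive a v (fun x => c * f x) (c * df).
Proof.
move=> [fd fE]; have := is_derive_mul (derivable_cst c a v) fd.
by move=> /is_derive_eq; apply; rewrite derive_cst mul0r add0r fE.
Qed.

Lemma is_derive_sumr I (r : seq I) (P : pred I) (f : I -> V -> R) (df : I -> R) :
  (forall i, is_derive a v (f i) (df i)) ->
  is_derive a v (fun x => \sum_(i <- r | P i) f i x) (\sum_(i <- r | P i) df i).
Proof.
move=> fd; elim: r => [|i r IH].
  rewrite (_ : (fun _ => _) = cst 0) ?big_nil; first exact: is_derive_cst.
  by apply/funext => x; rewrite big_nil.
rewrite big_cons; case Pi : (P i).
  rewrite (_ : (fun _ => _) = (f i + fun x => \sum_(i <- r | P i) f i x)).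
    exact: is_deriveD.
  by apply/funext => x; rewrite big_cons Pi.
by under eq_fun do rewrite big_cons Pi.
Qed.

(** The derivative is written as full products with the factor [k] replaced, the shape of a term of
    a determinant whose row [k] has been replaced. Uniqueness in [r] makes the test [i == k] pick a
    single factor. *)
Lemma is_derive_prodr (I : eqType) (r : seq I) (f : I -> V -> R) (df : I -> R) :
  uniq r -> (forall i, is_derive a v (f i) (df i)) ->
  is_derive a v (fun x => \prod_(i <- r) f i x)
    (\sum_(k <- r) \prod_(i <- r) (if i == k then df k else f i a)).
Proof.
move=> + fd; elim: r => [_|i r IH /= /andP[ir /IH {}IH]].
  rewrite (_ : (fun _ => _) = cst 1) ?big_nil; first exact: is_derive_cst.
  by apply/funext => x; rewrite big_nil.
rewrite (_ : (fun _ => _) = (fun x => f i x * \prod_(j <- r) f j x)); last first.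
  by apply/funext => x; rewrite big_cons.
have [di Ei] := fd i; have [dr Er] := IH.
have := is_derive_mul di dr; rewrite Ei Er; move=> /is_derive_eq; apply.
rewrite big_cons big_cons eqxx mulr_sumr; congr (_ * _ + _).
  apply: eq_big_seq => j jr.
  by case: eqP => // ji; rewrite -ji jr in ir.
apply: eq_big_seq => j jr; rewrite big_cons.
by case: eqP => // ij; rewrite ij jr in ir.
Qed.

Lemma derivemxM m n p (F : V -> 'M[R]_(m, n)) (G : V -> 'M[R]_(n, p)) :
  derivable_entries F -> derivable_entries G ->
  derivemx v (fun x => F x *m G x) a = derivemx v F a *m G a + F a *m derivemx v G a.
Proof.
move=> dF dG; apply/matrixP => i j; rewrite !mxE.
under [fun x => (_ *m _) _ _]eq_fun do rewrite mxE.
have := @is_derive_sumr _ (index_enum 'I_n) xpredT _ _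
  (fun k => is_derive_mul (dF i k) (dG k j)).
by move=> [_ ->]; rewrite big_split; congr (_ + _); apply: eq_bigr => k _; rewrite !mxE.
Qed.

Lemma derivemxD m n (F G : V -> 'M[R]_(m, n)) :
  derivable_entries F -> derivable_entries G ->
  derivemx v (fun x => F x + G x) a = derivemx v F a + derivemx v G a.
Proof.
move=> dF dG; apply/matrixP => i j; rewrite !mxE.
rewrite (_ : (fun x => (F x + G x) i j) = (fun x => F x i j + G x i j)); last first.
  by apply/funext => x; rewrite mxE.
exact: (deriveD (dF i j) (dG i j)).
Qed.

Lemma derivemxN m n (F : V -> 'M[R]_(m, n)) :
  derivable_entries F -> derivemx v (fun x => - F x) a = - derivemx v F a.
Proof.
move=> dF; apply/matrixP => i j; rewrite !mxE.
rewrite (_ : (fun x => (- F x) i j) = (fun x => - F x i j)); last first.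
  by apply/funext => x; rewrite mxE.
exact: (deriveN (dF i j)).
Qed.

Lemma derivemxZ m n (c : R) (F : V -> 'M[R]_(m, n)) :
  derivable_entries F -> derivemx v (fun x => c *: F x) a = c *: derivemx v F a.
Proof.
move=> dF; apply/matrixP => i j; rewrite !mxE.
rewrite (_ : (fun x => (c *: F x) i j) = (fun x => c * F x i j)); last first.
  by apply/funext => x; rewrite mxE.
exact: (@derive_val _ _ _ _ _ _ _ (is_derive_cmul c (derivableP (dF i j)))).
Qed.

Lemma derivemx_cst m n (A : 'M[R]_(m, n)) : derivemx v (fun=> A) a = 0.
Proof. by apply/matrixP => i j; rewrite !mxE derive_cst. Qed.

Lemma is_derive_trace m (F : V -> 'M[R]_m) : derivable_entries F ->
  is_derive a v (fun x => \tr (F x)) (\tr (derivemx v F a)).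
Proof.
move=> dF; apply: is_derive_sumr => i; rewrite mxE; exact/derivableP/dF.
Qed.

(** Jacobi's formula: the derivative is the sum over [k] of the determinants with row [k]
    differentiated, and Laplace expansion along that row brings out the cofactors. *)
Lemma is_derive_det m (F : V -> 'M[R]_m) : derivable_entries F ->
  is_derive a v (fun x => \det (F x)) (\tr (\adj (F a) *m derivemx v F a)).
Proof.
move=> dF; pose dFa := derivemx v F a.
have dE i j : is_derive a v (fun x => F x i j) (dFa i j).
  by rewrite mxE; exact/derivableP/dF.
pose Rk k : 'M[R]_m := \matrix_(i, j) (if i == k then dFa i j else F a i j).
suff : is_derive a v (fun x => \det (F x)) (\sum_k \det (Rk k)).
  move=> /is_derive_eq; apply; rewrite /mxtrace.
  under [RHS]eq_bigr do rewrite mxE.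
  rewrite [RHS]exchange_big /=; apply: eq_bigr => k _.
  rewrite (expand_det_row _ k); apply: eq_bigr => j _.
  rewrite mulrC !mxE eqxx; congr (_ * _).
  rewrite /cofactor; congr (_ * \det _); apply/matrixP => i' j'.
  by rewrite !mxE eq_sym (negPf (neq_lift _ _)).
have dprod := fun s : 'S_m => @is_derive_prodr _ (index_enum 'I_m) _ _ (index_enum_uniq _)
  (fun i => dE i (s i)).
have -> : \sum_k \det (Rk k) = \sum_(s : 'S_m)
    (-1) ^+ s * \sum_k \prod_i (if i == k then dFa k (s k) else F a i (s i)).
  under [RHS]eq_bigr do rewrite mulr_sumr.
  rewrite [RHS]exchange_big; apply: eq_bigr => k _; apply: eq_bigr => s _.
  congr (_ * _); apply: eq_bigr => i _; rewrite mxE.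
  by case: eqP => [->|].
by apply: is_derive_sumr => s; exact/is_derive_cmul/dprod.
Qed.

End derivative_rules.

Lemma is_derive_ln_det (R : realType) m (F : R -> 'M[R]_m) (a : R) :
  entries_in (fun f : R -> R => derivable f a 1) F -> 0 < \det (F a) ->
  is_derive a 1 (fun t => ln (\det (F t))) (\tr (invmx (F a) *m derivemx (1 : R) F a)).
Proof.
move=> dF d0; have [dd dE] := is_derive_det dF.
have uF : F a \in unitmx by rewrite unitmxE unitfE gt_eqF.
have := @is_derive1_comp _ _ _ a _ _ (is_derive1_ln d0) (DeriveDef dd dE).
move=> /is_derive_eq; apply.
by rewrite /invmx uF -scalemxAl linearZ /= mulrC.
Qed.

(** * Smooth functions as an algebra closed under square roots *)

Section smooth_algebra.
Context {R : realType} {n : nat}.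
Local Notation T := ('rV[R]_n).
Implicit Types (f g : T -> R).
Local Notation e_ i := (delta_mx 0 i : T).

(* [smooth] is coinductive in nature; closing [B] up under the ring operations
   reduces smoothness to first derivatives of the members of [B]. *)
Inductive generated (B : (T -> R) -> Prop) : (T -> R) -> Prop :=
| gen_base f of B f : generated B f
| gen_cst (c : R) : generated B (fun=> c)
| gen_add f g of generated B f & generated B g : generated B (fun x => f x + g x)
| gen_mul f g of generated B f & generated B g : generated B (fun x => f x * g x)
| gen_inv f of (forall x, f x != 0) & generated B f : generated B (fun x => (f x)^-1).

Lemma generated_algebra B : function_algebra (generated B).
Proof.
by split; [exact: gen_cst|exact: gen_add|exact: gen_mul|exact: gen_inv].
Qed.

Definition differentiable_into (K : (T -> R) -> Prop) f : Prop :=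
  continuous f /\ forall i, (forall x, derivable f x (e_ i)) /\ K (partial i f).

Lemma smoothP f : smooth f <-> differentiable_into smooth f.
Proof.
split=> [sf|[cf df] s].
  split; first exact: (sf [::]).1.
  move=> i; split=> [x|s]; first exact: (sf [::]).2.
  by have := sf (rcons s i); rewrite foldr_rcons.
elim/last_ind: s => [|s i _]; first by split => // i y; have [] := df i.
by rewrite foldr_rcons; have [_ /(_ s)] := df i.
Qed.

Lemma smooth_coind (K : (T -> R) -> Prop) :
  (forall f, K f -> differentiable_into K f) -> forall f, K f -> smooth f.
Proof.
move=> Kd f Kf s; elim/last_ind: s f Kf => [|s i IH] f Kf.
  by have [cf df] := Kd f Kf; split => // i y; have [] := df i.
by rewrite foldr_rcons; apply: IH; have [_ /(_ i)[]] := Kd f Kf.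
Qed.

Lemma generated_differentiable B :
  (forall f, B f -> differentiable_into (generated B) f) ->
  forall f, generated B f -> differentiable_into (generated B) f.
Proof.
move=> dB f; have [cc cD cM cV] := @continuous_algebra R T; elim=> {f}.
- exact: dB.
- move=> c; split; first exact: cc.
  move=> i; split=> [x|]; first exact: derivable_cst.
  rewrite (_ : partial i _ = fun=> 0); first exact: gen_cst.
  by apply/funext => x; rewrite /partial derive_cst.
- move=> f g _ [cf df] _ [cg dg]; split; first exact: cD.
  move=> i; have [df' pf] := df i; have [dg' pg] := dg i; split=> [x|].
    exact: (derivableD (df' x) (dg' x)).
  rewrite (_ : partial i _ = fun x => partial i f x + partial i g x).
    exact: gen_add.
  by apply/funext => x; exact: (deriveD (df' x) (dg' x)).
- move=> f g gf [cf df] gg [cg dg]; split; first exact: cM.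
  move=> i; have [df' pf] := df i; have [dg' pg] := dg i; split=> [x|].
    exact: (derivableM (df' x) (dg' x)).
  rewrite (_ : partial i _ = fun x => partial i f x * g x + f x * partial i g x).
    by apply: gen_add; apply: gen_mul.
  by apply/funext => x; exact: (@derive_val _ _ _ _ _ _ _ (is_derive_mul (df' x) (dg' x))).
- move=> f f0 gf [cf df]; split; first exact: cV.
  move=> i; have [df' pf] := df i; split=> [x|].
    exact: (derivableV (f0 x) (df' x)).
  rewrite (_ : partial i _ = fun x => -1 * ((f x)^-1 * (f x)^-1 * partial i f x)).
    by do ?apply: gen_mul => //; [exact: gen_cst|exact: gen_inv..].
  apply/funext => x; rewrite /partial (deriveV (f0 x) (df' x)) /GRing.scale/=.
  by rewrite expr2 invfM mulN1r mulNr.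
Qed.

Lemma generated_smooth B :
  (forall f, B f -> differentiable_into (generated B) f) ->
  forall f, generated B f -> smooth f.
Proof. by move=> dB; apply: smooth_coind; exact: generated_differentiable. Qed.

Lemma smooth_algebra : function_algebra (@smooth R n).
Proof.
have dB f : smooth f -> differentiable_into (generated (@smooth R n)) f.
  move=> /smoothP[cf df]; split=> // i; have [df' pf] := df i; split => //.
  exact: gen_base.
have gs := generated_smooth dB.
split=> [c|f g sf sg|f g sf sg|f f0 sf]; apply: gs.
- exact: gen_cst.
- by apply: gen_add; exact: gen_base.
- by apply: gen_mul; exact: gen_base.
- by apply: gen_inv => //; exact: gen_base.
Qed.

(* The derivatives of a square root [F] solve a Sylvester equation with
   coefficient [F], hence are rational in [F] and the derivatives of [F^2]. *)
Lemma smooth_sqrt_closed : sqrt_closed (@smooth R n).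
Proof.
move=> m F M pF FM sM.
have dM x k : entries_in (derivable_at (e_ k) x) M.
  by move=> i j; have /smoothP[cM /(_ k)[]] := sM i j; split.
have dF x k : entries_in (derivable_at (e_ k) x) F.
  exact: (derivable_at_sqrt_closed pF FM (dM x k)).
(* The derivative of an entry of [F] is not in [B] but is a rational expression in members of [B]:
   entries of [F] and derivatives of entries of [M]. *)
pose B f := smooth f \/ exists i j, f = fun x => F x i j.
have algB := generated_algebra B.
have gM i j : generated B (fun x => M x i j) by apply: gen_base; left.
have gF i j : generated B (fun x => F x i j).
  by apply: gen_base; right; exists i, j.
have uF x : sylvester (F x) (F x) \in unitmx by exact: sylvester_unit.
have DF k x : derivemx (e_ k) F x =
    vec_mx (mxvec (derivemx (e_ k) M x) *m invmx (sylvester (F x) (F x))).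
  rewrite -[LHS]mxvecK; congr vec_mx.
  rewrite -[LHS](mulmxK (uF x)) mul_vec_sylvester; congr (mxvec _ *m _).
  have dF' : entries_in (fun f : T -> R => derivable f x (e_ k)) F.
    by move=> i j; case: (dF x k i j).
  have -> : M = (fun x => F x *m F x) by apply/funext => z; rewrite FM.
  by rewrite (derivemxM dF' dF') addrC.
suff dB f : B f -> differentiable_into (generated B) f.
  by move=> i j; exact: (generated_smooth dB).
move=> [/smoothP[cf df]|[i [j ->]]].
  split=> // i; have [df' pf] := df i; split => //.
  by apply: gen_base; left.
have cM : entries_in (fun f : T -> R => continuous f) M.
  by move=> i' j'; have /smoothP[] := sM i' j'.
split=> [|k]; first exact: (continuous_sqrt_closed pF FM cM).
split=> [x|]; first by case: (dF x k i j).
rewrite (_ : partial k _ = fun x => derivemx (e_ k) F x i j); last first.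
  by apply/funext => x; rewrite mxE.
under eq_fun do rewrite DF.
apply: (entries_vec_mx _ i j); apply: entriesM => //.
  apply: entries_mxvec => i' j'; under eq_fun do rewrite mxE.
  by apply: gen_base; left; have /smoothP[_ /(_ k)[]] := sM i' j'.
by apply: entries_inv => //; exact: entries_sylvester.
Qed.
End smooth_algebra.

(** * Smooth functions on the torus *)

Section scalars.
Context {R : realFieldType}.
Implicit Types x y z t h e : R.

Lemma mulrr_cancel x y h : h != 0 -> x * h * h = y * h * h -> x = y.
Proof. by move=> h0 /(mulIf h0)/(mulIf h0). Qed.

Lemma subB_swap x y z t : x - y - (z - t) = x - z - (y - t).
Proof. ring. Qed.

Lemma dist_double_lt x y z e : `|x - z| < e -> `|y - z| < e -> `|x - y| < e + e.
Proof.
move=> xz yz; have -> : x - y = (x - z) - (y - z) by ring.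
by apply: le_lt_trans (ler_normB _ _) _; rewrite ltrD.
Qed.
End scalars.

(** * Symmetry of second derivatives *)

Section clairaut.
Context {R : realType} {V : normedModType R}.
Implicit Types (f : V -> R) (v w a : V).

Lemma is_derive_line f a v (t : R) : derivable f (t *: v + a) v ->
  is_derive t 1 (fun s : R => f (s *: v + a)) ('D_v f (t *: v + a)).
Proof.
have E : (fun h : R => h^-1 *: (((fun s : R => f (s *: v + a)) \o shift t) (h *: 1) - f (t *: v + a)))
    = (fun h : R => h^-1 *: ((f \o shift (t *: v + a)) (h *: v) - f (t *: v + a))).
  by apply/funext => h /=; rewrite scalerDl addrA [h *: 1]mulr1.
by move=> df; split; rewrite /derivable /derive E.
Qed.

Lemma mean_value_line f a v (h : R) : 0 < h -> (forall y, derivable f y v) ->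
  exists2 c, 0 < c < h & f (h *: v + a) - f a = 'D_v f (c *: v + a) * h.
Proof.
move=> h0 df.
have dl t := is_derive_line (df (t *: v + a)).
have [|c + E] := @MVT _ (fun s => f (s *: v + a)) (fun t => 'D_v f (t *: v + a)) 0 h h0 (fun t _ => dl t).
  by apply: derivable_within_continuous => t _; exact: (@ex_derive _ _ _ _ _ _ _ (dl t)).
rewrite in_itv /= => ch; exists c => //.
by rewrite -[X in _ * X]subr0 -E scale0r add0r.
Qed.

(** The mean value theorem is applied along [v] to the increment [f (y + h w) - f y], then along [w]
    to the derivative of [f] in direction [v]. *)
Lemma mixed_difference f a v w (h : R) : 0 < h ->
  (forall y, derivable f y v) -> (forall y, derivable ('D_v f) y w) ->
  exists c d, [/\ 0 < c < h, 0 < d < h &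
   f (h *: v + (h *: w + a)) - f (h *: v + a) - (f (h *: w + a) - f a) =
   'D_w ('D_v f) (d *: w + (c *: v + a)) * h * h].
Proof.
move=> h0 df ddf; pose g y := f (y + h *: w) - f y.
have dg y : is_derive y v g ('D_v f (y + h *: w) - 'D_v f y).
  apply: is_deriveB; last exact/derivableP.
  have qE : (fun k : R => k^-1 *: (((fun z => f (z + h *: w)) \o shift y) (k *: v) - f (y + h *: w)))
      = (fun k : R => k^-1 *: ((f \o shift (y + h *: w)) (k *: v) - f (y + h *: w))).
    by apply/funext => k /=; rewrite addrA.
  by split; rewrite /derivable /derive qE //; exact: df.
have [c ch gE] := @mean_value_line g a v h h0 (fun y => @ex_derive _ _ _ _ _ _ _ (dg y)).
have [d dh DE] := @mean_value_line ('D_v f) (c *: v + a) w h h0 ddf.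
exists c, d; split => //; rewrite -DE [h *: w + (c *: v + a)]addrC.
rewrite -(@derive_val _ _ _ _ _ _ _ (dg _)) -gE /g.
by rewrite addrA -[h *: v + h *: w + a]addrAC [h *: w + a]addrC.
Qed.

(** The second difference is symmetric in [v] and [w], and equals [h^2] times either mixed
    derivative at some point close to [a]. Continuity at [a] then forces the two values together. *)
Lemma clairaut f a v w :
  (forall y, derivable f y v) -> (forall y, derivable f y w) ->
  (forall y, derivable ('D_v f) y w) -> (forall y, derivable ('D_w f) y v) ->
  {for a, continuous ('D_w ('D_v f))} -> {for a, continuous ('D_v ('D_w f))} ->
  'D_w ('D_v f) a = 'D_v ('D_w f) a.
Proof.
move=> dv dw dvw dwv cvw cwv; apply/eqP/negPn/negP => ne.
set A : R := 'D_w ('D_v f) a in ne *; set B : R := 'D_v ('D_w f) a in ne *.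
pose e : R := `|A - B| / 2; have e0 : 0 < e by rewrite divr_gt0// normr_gt0 subr_eq0.
have /cvgrPdist_lt/(_ _ e0)/nbhs_ballP[r1 /= r10 H1] := cvw.
have /cvgrPdist_lt/(_ _ e0)/nbhs_ballP[r2 /= r20 H2] := cwv.
pose r := Num.min r1 r2; have r0 : 0 < r by rewrite lt_min r10.
(* With [h = r / N] every [a + c v + d w], [0 < c, d < h], lies within [r] of [a]; the summand 1
   keeps [N] positive when [v] and [w] vanish. *)
pose N := `|v| + `|w| + 1; have N0 : 0 < N by rewrite ltr_wpDl// addr_ge0.
pose h := r / N; have h0 : 0 < h by rewrite divr_gt0.
have near c d : 0 < c < h -> 0 < d < h -> `|a - (d *: w + (c *: v + a))| < r.
  move=> /andP[c0 ch] /andP[d0 dh].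
  rewrite addrA opprD addrCA subrr addr0 normrN.
  apply: le_lt_trans (ler_normD _ _) _; rewrite !normrZ !gtr0_norm//.
  apply: (@le_lt_trans _ _ (h * (`|v| + `|w|))).
    by rewrite mulrDr addrC lerD// ler_wpM2r// ltW.
  rewrite /h mulrAC ltr_pdivrMr// ltr_pM2l// /N.
  by rewrite ltrDl.
have [c [d [ch dh E]]] := mixed_difference a h0 dv dvw.
have [c' [d' [ch' dh' E']]] := mixed_difference a h0 dw dwv.
have EE : 'D_w ('D_v f) (d *: w + (c *: v + a)) = 'D_v ('D_w f) (d' *: v + (c' *: w + a)).
  apply: (mulrr_cancel (lt0r_neq0 h0)); apply: (etrans (esym E)); apply: (etrans _ E').
  have -> : h *: w + (h *: v + a) = h *: v + (h *: w + a) by rewrite addrCA.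
  exact: subB_swap.
have {}H1 := H1 (d *: w + (c *: v + a)); have {}H2 := H2 (d' *: v + (c' *: w + a)).
have h1 : `|A - 'D_w ('D_v f) (d *: w + (c *: v + a))| < e.
  by apply: H1; rewrite -ball_normE /ball_ /=; apply: lt_le_trans (near _ _ ch dh) _; rewrite ge_min lexx.
have h2 : `|B - 'D_v ('D_w f) (d' *: v + (c' *: w + a))| < e.
  apply: H2; rewrite -ball_normE /ball_ /= [d' *: v + _]addrCA.
  by apply: lt_le_trans (near _ _ dh' ch') _; rewrite ge_min lexx orbT.
rewrite EE in h1.
have := dist_double_lt h1 h2; rewrite /e -splitr ltxx.
by [].
Qed.
End clairaut.

Section torus_functions.
Context {R : realType} {n : nat}.
Local Notation T := ('rV[R]_n).
Implicit Types (f u : T -> R).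

Lemma smooth_partial i f : smooth f -> smooth (partial i f).
Proof. by move=> /smoothP[_ /(_ i)[]]. Qed.

Lemma smooth_derivable i f y : smooth f -> derivable f y (delta_mx 0 i).
Proof. by move=> /smoothP[_ /(_ i)[]]. Qed.

Lemma smooth_continuous f : smooth f -> continuous f.
Proof. by move=> /smoothP[]. Qed.

Lemma partialC i j f : smooth f -> partial i (partial j f) = partial j (partial i f).
Proof.
move=> sf; apply/funext => y; apply: clairaut => [z|z|z|z||].
- exact: smooth_derivable.
- exact: smooth_derivable.
- exact/smooth_derivable/smooth_partial.
- exact/smooth_derivable/smooth_partial.
- exact/smooth_continuous/smooth_partial/smooth_partial.
- exact/smooth_continuous/smooth_partial/smooth_partial.
Qed.

Lemma is_derive_coord (i : 'I_n) (y v : T) : is_derive y v (fun x : T => x 0 i) (v 0 i).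
Proof.
have did := @derivable_id R T y v.
split; first by have /derivable_mxP/(_ 0 i) := did.
by have := derive_mx did; rewrite derive_id => /matrixP/(_ 0 i); rewrite mxE.
Qed.

Lemma smooth_coord (i : 'I_n) : smooth (fun x : T => x 0 i).
Proof.
apply/smoothP; split; first exact: coord_continuous.
move=> j; split=> [y|]; first exact: (@ex_derive _ _ _ _ _ _ _ (is_derive_coord i y _)).
rewrite (_ : partial j _ = fun=> (delta_mx 0 j : T) 0 i).
  exact: (alg_cst smooth_algebra).
by apply/funext => y; exact: (@derive_val _ _ _ _ _ _ _ (is_derive_coord i y _)).
Qed.

Lemma partialD i f g : smooth f -> smooth g ->
  partial i (fun x => f x + g x) = fun x => partial i f x + partial i g x.
Proof.
move=> sf sg; apply/funext => y.
by have := deriveD (@smooth_derivable i _ y sf) (@smooth_derivable i _ y sg).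
Qed.

Lemma partialM i f g : smooth f -> smooth g ->
  partial i (fun x => f x * g x) = fun x => partial i f x * g x + f x * partial i g x.
Proof.
move=> sf sg; apply/funext => y.
exact: (@derive_val _ _ _ _ _ _ _ (is_derive_mul (@smooth_derivable i _ y sf) (@smooth_derivable i _ y sg))).
Qed.

Lemma partial_sum I (r : seq I) i (f : I -> T -> R) : (forall k, smooth (f k)) ->
  partial i (fun x => \sum_(k <- r) f k x) = fun x => \sum_(k <- r) partial i (f k) x.
Proof.
move=> sf; apply/funext => y; apply: (@derive_val _ _ _ _ _ _ _ (is_derive_sumr r xpredT _)) => k.
exact/derivableP/smooth_derivable.
Qed.

Lemma partial_cst (i : 'I_n) (c : R) : partial i (fun _ : T => c) = fun=> 0.
Proof. by apply/funext => y; exact: derive_cst. Qed.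

Lemma periodic_partial i f : Defs.periodic f -> Defs.periodic (partial i f).
Proof.
move=> pf k y; rewrite /partial /derive.
rewrite (_ : (fun h : R => _) = (fun h : R => h^-1 *: ((f \o shift y) (h *: delta_mx 0 i) - f y)))//.
by apply/funext => h /=; rewrite pf addrA pf.
Qed.

Lemma symplectic_smooth u : symplectic_potential u -> smooth u.
Proof.
move=> [[f [sf _] uE] _].
rewrite (_ : u = fun y => 2^-1 * (\sum_i y 0 i * y 0 i) + f y).
  apply: (algD smooth_algebra _ sf); apply: (algM smooth_algebra); first exact: (alg_cst smooth_algebra).
  by apply: (alg_sum smooth_algebra) => i; apply: (algM smooth_algebra); exact: smooth_coord.
by apply/funext => y; rewrite uE; congr (_ * _ + _); apply: eq_bigr => i _; rewrite expr2.
Qed.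

Lemma hessian_entry u a b : (fun y => hessian u y a b) = partial b (partial a u).
Proof. by apply/funext => y; rewrite mxE. Qed.

Lemma smooth_hessian u : smooth u -> entries_in (@smooth R n) (hessian u).
Proof. by move=> su a b; rewrite hessian_entry; do 2!apply: smooth_partial. Qed.

Lemma hessian_sym u y : smooth u -> (hessian u y)^T = hessian u y.
Proof. by move=> su; apply/matrixP => a b; rewrite !mxE partialC. Qed.

Lemma hessian_vary u v t y : smooth u -> smooth v ->
  hessian (vary u v t) y = hessian u y + t *: hessian v y.
Proof.
move=> su sv; have sc : smooth (fun _ : T => t) by exact: (alg_cst smooth_algebra).
have stv f : smooth f -> smooth (fun x => t * f x).
  by move=> sf; exact: (algM smooth_algebra).
have pt i f : smooth f -> partial i (fun x => t * f x) = fun x => t * partial i f x.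
  by move=> sf; rewrite (partialM _ sc sf); apply/funext => x; rewrite partial_cst mul0r add0r.
apply/matrixP => a b; rewrite !mxE /vary.
rewrite (partialD _ su (stv _ sv)) (pt _ _ sv) partialD.
- by rewrite (pt _ _ (smooth_partial _ sv)).
- exact: smooth_partial.
- exact/stv/smooth_partial.
Qed.

(** [u] is not periodic, but its quadratic part has constant second derivatives, and the remainder
    is periodic. *)
Lemma hessian_periodic u : symplectic_potential u -> Defs.periodic (hessian u).
Proof.
move=> [[f [sf pf] uE] _] k y; apply/matrixP => a b.
have E z : hessian u z a b = partial b (partial a u) z by rewrite mxE.
apply: (etrans (E _)); apply: (etrans _ (esym (E y))).
pose q (x : T) : R := 2^-1 * \sum_i x 0 i * x 0 i.
have sq : smooth q.
  apply: (algM smooth_algebra); first exact: (alg_cst smooth_algebra).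
  by apply: (alg_sum smooth_algebra) => i; apply: (algM smooth_algebra); exact: smooth_coord.
have -> : u = fun x => q x + f x.
  by apply/funext => x; rewrite uE; congr (_ * _ + _); apply: eq_bigr => i _; rewrite expr2.
rewrite (partialD _ sq sf) partialD; [|exact: smooth_partial..].
have pcoord i j : partial i (fun x : T => x 0 j) = fun=> (delta_mx 0 i : T) 0 j.
  by apply/funext => x; exact: (@derive_val _ _ _ _ _ _ _ (is_derive_coord j x _)).
have pq i : partial i q = fun x => \sum_j (delta_mx 0 i : T) 0 j * x 0 j.
  rewrite partialM; [|exact: (alg_cst smooth_algebra)|]; last first.
    by apply: (alg_sum smooth_algebra) => j; apply: (algM smooth_algebra); exact: smooth_coord.
  apply/funext => x; rewrite partial_cst mul0r add0r partial_sum; last first.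
    by move=> j; apply: (algM smooth_algebra); exact: smooth_coord.
  rewrite mulr_sumr; apply: eq_bigr => j _; rewrite partialM; try exact: smooth_coord.
  by rewrite pcoord; field.
have -> : partial b (partial a q) = fun=> \sum_j (delta_mx 0 a : T) 0 j * (delta_mx 0 b : T) 0 j.
  rewrite pq partial_sum => [|j]; last by apply: (algM smooth_algebra); [exact: (alg_cst smooth_algebra)|exact: smooth_coord].
  apply/funext => x; apply: eq_bigr => j _; rewrite partialM; [|exact: (alg_cst smooth_algebra)|exact: smooth_coord].
  by rewrite partial_cst mul0r add0r pcoord.
by rewrite (periodic_partial _ (periodic_partial _ pf)).
Qed.
End torus_functions.

(** * Integration over the torus *)

Lemma cvg_mx (R : realType) (I : Type) (F : set_system I) m n
    (f : I -> 'M[R]_(m, n)) (l : 'M[R]_(m, n)) : Filter F ->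
  (forall i j, f x i j @[x --> F] --> l i j) -> f x @[x --> F] --> l.
Proof.
move=> FF fl; apply/cvg_ballP => e e0.
have : \forall x \near F, forall ij : 'I_m * 'I_n, ball (l ij.1 ij.2) e (f x ij.1 ij.2).
  apply: filter_forall => -[i j] /=.
  by move/cvg_ballP : (fl i j); apply.
by apply: filterS => x H; split => // i j; exact: (H (i, j)).
Qed.

Lemma continuous_mx (R : realType) (T : topologicalType) m n (f : T -> 'M[R]_(m, n)) :
  (forall i j, continuous (fun x => f x i j)) -> continuous f.
Proof. by move=> cf x; apply: cvg_mx => i j; exact: cf. Qed.

Lemma continuous_bounded_on (R : realType) (T : topologicalType) (f : T -> R) (A : set T) : continuous f -> compact A ->
  exists M, forall y, A y -> `|f y| <= M.
Proof.
move=> cf cA; have /compact_bounded[M [_ HM]] : compact (f @` A).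
  by apply: continuous_compact => //; exact: continuous_subspaceT.
by exists (`|M| + 1) => y Ay; apply: HM; [rewrite ltr_pwDr// ler_norm|exists y].
Qed.

Section measurability.
Context {R : realType} {n : nat}.
Local Notation T := ('rV[R]_n).
Local Notation RT := (measurableTypeR R).

Definition row_of (t : n.-tuple RT) : T := \row_i tnth t i.

Definition floor_row (k : nat) (t : n.-tuple RT) : 'rV[int]_n :=
  \row_i Num.floor (k.+1%:R * tnth t i).

Lemma measurable_floor_row k (z : 'rV[int]_n) :
  measurable [set t | floor_row k t = z].
Proof.
rewrite (_ : [set _ | _] = \bigcap_(i in [set: 'I_n])
    ((fun t => tnth t i) @^-1` [set x : RT | (z 0 i)%:~R <= k.+1%:R * x < (z 0 i + 1)%:~R])).
  apply: fin_bigcap_measurable => // i _; rewrite -[X in measurable X]setTI.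
  apply: measurable_tnth => //.
  rewrite (_ : [set _ | _] = `[k.+1%:R^-1 * (z 0 i)%:~R, k.+1%:R^-1 * (z 0 i + 1)%:~R[%classic) //.
  apply/seteqP; split=> x /=; rewrite in_itv/= ler_pdivrMl ?ltr0n// ltr_pdivlMl ?ltr0n//.
apply/seteqP; split=> t /=.
  by move=> <- i _ /=; rewrite mxE floor_itv.
move=> tz; apply/rowP => i; rewrite mxE; apply: floor_def; exact: tz.
Qed.

(** [f] is the pointwise limit of its values at the lower corners of the grid cells of side
    [1 / (k + 1)]. Each approximant depends on [floor_row k] alone, which has countably many values
    and measurable fibres. *)
Lemma measurable_continuous_row (f : T -> R) : continuous f ->
  measurable_fun [set: n.-tuple RT] (f \o row_of).
Proof.
move=> cf; pose q k t : T := \row_i (k.+1%:R^-1 * (floor_row k t 0 i)%:~R).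
apply: (@measurable_fun_cvg _ _ _ _ (fun k => f \o q k)) => [k|t _]; last first.
  suff: q k t @[k --> \oo] --> row_of t by move=> /cvg_comp; apply; exact: cf.
  apply: cvg_mx => i j; rewrite /row_of /q.
  under eq_fun do rewrite mxE; rewrite mxE.
  apply: (@squeeze_cvgr _ _ _ _ (fun k => tnth t j - k.+1%:R^-1) (fun=> tnth t j)).
  - apply: nearW => k; rewrite mxE lerBlDr.
    have /andP[h1 h2] := floor_itv (k.+1%:R * tnth t j).
    have k0 : 0 < k.+1%:R :> R by rewrite ltr0n.
    rewrite ler_pdivrMl// h1 andbT -[X in _ + X]mulr1 -mulrDr ler_pdivlMl//.
    by apply: ltW; move: h2; rewrite intrD.
  - rewrite -[X in _ --> X]subr0; apply: cvgB; first exact: cvg_cst.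
    exact: cvg_harmonic.
  - exact: cvg_cst.
move=> _ B mB; rewrite setTI.
pose g (z : 'rV[int]_n) : T := \row_i (k.+1%:R^-1 * (z 0 i)%:~R).
rewrite (_ : _ @^-1` B = \bigcup_z (if z \in [set z | B (f (g z))] then
    [set t | floor_row k t = z] else set0)).
  apply: countable_bigcupT_measurable; first exact: countableP.
  by move=> z; case: ifP => // _; exact: measurable_floor_row.
apply/seteqP; split=> t /=.
  by move=> Bt; exists (floor_row k t) => //; case: ifPn => //; rewrite notin_setE.
by move=> [z _]; case: ifPn => //; rewrite inE => /= Bz tz; rewrite /q tz.
Qed.

Definition cube : set T := [set y | forall i, y 0 i \in `[0, 1]].

Lemma compact_cube : compact cube.
Proof.
have := @rV_compact R n (fun=> `[0, 1]%classic) (fun=> @segment_compact R 0 1).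
by [].
Qed.

Lemma row_of_cube t : unit_cube t -> cube (row_of t).
Proof. by move=> tc i; rewrite mxE; exact: tc. Qed.

Lemma lebesgue_tuple_cube : lebesgue_tuple n (@unit_cube R n) = 1%E.
Proof.
have mI (i : 'I_n) : measurable (`[0, 1]%classic : set RT) by exact: measurable_itv.
have := lebesgue_tuple_box mI.
rewrite /unit_cube => ->; rewrite big1// => i _.
by rewrite /= lebesgue_measure_itv/= lte_fin ltr01 -EFinD subr0.
Qed.

Lemma measurable_unit_cube : measurable (@unit_cube R n).
Proof.
rewrite (_ : unit_cube = \bigcap_(i in [set: 'I_n]) ((fun t => tnth t i) @^-1` `[0, 1]%classic)).
  apply: fin_bigcap_measurable => // i _; rewrite -[X in measurable X]setTI.
  exact: measurable_tnth.
by apply/seteqP; split=> t /= tc i; [move=> _; exact: tc|exact: tc].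
Qed.

Lemma integrable_cube (f : T -> R) : continuous f ->
  (lebesgue_tuple n).-integrable unit_cube (EFin \o (f \o row_of)).
Proof.
move=> cf; have fin : (lebesgue_tuple n (@unit_cube R n) < +oo)%E.
  by rewrite lebesgue_tuple_cube ltry.
apply: measurable_bounded_integrable.
- exact: measurable_unit_cube.
- exact: fin.
- by apply: measurable_funTS; exact: measurable_continuous_row.
have [M HM] := continuous_bounded_on cf compact_cube.
exists M; split; first exact: num_real.
by move=> x Mx t tc /=; apply: le_trans (ltW Mx); exact/HM/row_of_cube.
Qed.

Lemma torus_integralE (f : T -> R) : continuous f ->
  (\int[lebesgue_tuple n]_(t in unit_cube) (f (row_of t))%:E)%E = (torus_integral f)%:E.
Proof.
move=> cf; rewrite /torus_integral /Rintegral fineK//.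
by apply: integrable_fin_num; [exact: measurable_unit_cube|exact: integrable_cube].
Qed.

Lemma torus_integralD (f g : T -> R) : continuous f -> continuous g ->
  torus_integral (fun y => f y + g y) = torus_integral f + torus_integral g.
Proof.
move=> cf cg; apply: RintegralD; [exact: measurable_unit_cube|exact: integrable_cube..].
Qed.

Lemma torus_integralZ (c : R) (f : T -> R) : continuous f ->
  torus_integral (fun y => c * f y) = c * torus_integral f.
Proof.
move=> cf; apply: RintegralZl; [exact: measurable_unit_cube|exact: integrable_cube].
Qed.

Lemma torus_integral_sum I (r : seq I) (f : I -> T -> R) : (forall i, continuous (f i)) ->
  torus_integral (fun y => \sum_(i <- r) f i y) = \sum_(i <- r) torus_integral (f i).
Proof.
move=> cf; elim: r => [|i r IH].
  rewrite big_nil (_ : (fun _ => _) = fun y => 0 * 0); last first.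
    by apply/funext => y; rewrite big_nil mul0r.
  by rewrite (torus_integralZ 0 (f := fun=> 0)) ?mul0r//; exact: cst_continuous.
rewrite big_cons -IH -torus_integralD//; last first.
  exact: (alg_sum continuous_algebra).
by congr torus_integral; apply/funext => y; rewrite big_cons.
Qed.

(* Otherwise the square is bounded below on a box of positive measure. *)
Lemma torus_integral_sqr_eq0 (f : T -> R) : continuous f ->
  torus_integral (fun y => f y * f y) = 0 -> forall y, cube y -> f y = 0.
Proof.
move=> cf f0 y yc; apply/eqP/negPn/negP => fy0.
pose g y := f y * f y.
have cg : continuous g by exact: (algM continuous_algebra).
have gy0 : 0 < g y by rewrite /g -expr2 lt_def sqr_ge0 andbT sqrf_eq0.
pose a := g y / 2; have a0 : 0 < a by rewrite divr_gt0.
have : \forall z \near y, a < g z.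
  by apply: (cvgr_gt _ (cg y)); rewrite /a ltr_pdivrMr// ltr_pMr// ltr1n.
move=> /nbhs_ballP[r /= r0 Hr].
(* Half-width [r / 2] keeps the box inside the ball of radius [r]; cutting by [[0, 1]] leaves a side
   of positive length even when [y] lies on the boundary of the cube. *)
pose A (i : 'I_n) : set RT := `[Num.max 0 (y 0 i - r / 2), Num.min 1 (y 0 i + r / 2)]%classic.
have mA i : measurable (A i) by exact: measurable_itv.
have Abox : [set t | forall i, A i (tnth t i)] `<=`
    unit_cube `&` [set t | (a%:E <= `|(g (row_of t))%:E|)%E].
  move=> t At; have H i := At i.
  have tc : unit_cube t.
    move=> i; have := H i; rewrite /A /= !in_itv /= ge_max le_min => /andP[/andP[-> _] /andP[-> _]].
    by [].
  split => //=; rewrite lee_fin; apply: ltW; apply: lt_le_trans (ler_norm _).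
  apply: Hr; split => // i j; rewrite (ord1 i) mxE /ball/=.
  have := H j; rewrite /A /= in_itv /= ge_max le_min => /andP[/andP[_ h1] /andP[_ h2]].
  rewrite ltr_norml; set s := tnth t j in h1 h2 *; set z := y 0 j in h1 h2 *.
  by apply/andP; split; lra.
have A0 : (0 < lebesgue_tuple n [set t | forall i, A i (tnth t i)])%E.
  rewrite lebesgue_tuple_box//; elim/big_ind: _ => // [x z x0 z0|i _].
    exact: mule_gt0.
  have := yc i; rewrite in_itv/= => /andP[y0 y1].
  rewrite /A lebesgue_measure_itv/= lte_fin.
  have lt : Num.max 0 (y 0 i - r / 2) < Num.min 1 (y 0 i + r / 2).
    set z := y 0 i in y0 y1 *; rewrite gt_max !lt_min ltr01 /=.
    by apply/andP; split; [|apply/andP; split]; lra.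
  by rewrite lt -EFinD lte_fin subr_gt0.
(* Chebyshev's inequality: [a] times the measure of the points where [g >= a] is at most the
   integral of [g], which is 0. *)
have := @le_integral_abse _ _ _ (lebesgue_tuple n) _ measurable_unit_cube
  (fun t => (g (row_of t))%:E) a.
move=> /(_ _ a0) H.
have mg : measurable_fun unit_cube (fun t : n.-tuple RT => (g (row_of t))%:E).
  apply/measurable_EFinP/measurable_funTS; exact: measurable_continuous_row.
have {H} := H mg.
have -> : (\int[lebesgue_tuple n]_(t in unit_cube) `|(g (row_of t))%:E|)%E = 0%E.
  rewrite -[RHS]/(0%:E) -f0 -torus_integralE//; apply: eq_integral => t _.
  by rewrite gee0_abs// lee_fin /g -expr2 sqr_ge0.
apply/negP; rewrite -ltNge; apply: mule_gt0; first by rewrite lte_fin.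
apply: lt_le_trans A0 _; apply: le_measure => //; rewrite inE.
- rewrite (_ : [set _ | _] = \bigcap_(i in [set: 'I_n]) ((fun t => tnth t i) @^-1` A i)).
    apply: fin_bigcap_measurable => // i _; rewrite -[X in measurable X]setTI.
    exact: measurable_tnth.
  by apply/seteqP; split=> t /= tc i; [move=> _; exact: tc|exact: tc].
- apply: emeasurable_fun_c_infty => //; first exact: measurable_unit_cube.
  exact: measurableT_comp.
Qed.

Lemma periodic_reduce (y : T) : exists k : 'rV[int]_n, cube (y + map_mx intr k).
Proof.
exists (\row_i - Num.floor (y 0 i)) => i; rewrite !mxE in_itv/= intrN.
have /andP[h1 h2] := floor_itv (y 0 i).
by rewrite subr_ge0 h1 lerBlDl ltW//; move: h2; rewrite intrD.
Qed.

Lemma periodic_cube (f : T -> R) : Defs.periodic f ->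
  (forall y, cube y -> f y = 0) -> forall y, f y = 0.
Proof.
by move=> pf f0 y; have [k yk] := periodic_reduce y; rewrite -(pf k); exact: f0.
Qed.

End measurability.

(** * Fubini on rectangles and integration by parts on the torus *)

Section fubini_rectangle.
Context d1 d2 (T1 : measurableType d1) (T2 : measurableType d2) (R : realType).
Variables (m1 : {sigma_finite_measure set T1 -> \bar R})
          (m2 : {sigma_finite_measure set T2 -> \bar R}).
Variables (A : set T1) (B : set T2) (g : T1 * T2 -> \bar R).
Hypotheses (mA : measurable A) (mB : measurable B).
Hypothesis ig : (m1 \x m2)%E.-integrable (A `*` B) g.

Let ig' : (m1 \x m2)%E.-integrable setT (g \_ (A `*` B)).
Proof. by apply/(integrable_mkcond _ _).1 => //; exact: measurableX. Qed.

Lemma fubini_rect12 : (\int[m1 \x m2]_(z in A `*` B) g z =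
  \int[m1]_(x in A) \int[m2]_(y in B) g (x, y))%E.
Proof.
rewrite integral_mkcond -(integral12_prod_meas1 ig') [RHS]integral_mkcond.
apply: eq_integral => x _; rewrite /patch; case: ifPn => xA.
  rewrite [RHS]integral_mkcond; apply: eq_integral => y _; rewrite /patch.
  by rewrite in_setX xA.
by apply: integral0_eq => y _; rewrite /patch in_setX (negPf xA).
Qed.

Lemma fubini_rect21 : (\int[m1 \x m2]_(z in A `*` B) g z =
  \int[m2]_(y in B) \int[m1]_(x in A) g (x, y))%E.
Proof.
rewrite integral_mkcond -(integral21_prod_meas1 ig') [RHS]integral_mkcond.
apply: eq_integral => y _; rewrite /patch; case: ifPn => yB.
  rewrite [RHS]integral_mkcond; apply: eq_integral => x _; rewrite /patch.
  by rewrite in_setX yB andbT.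
by apply: integral0_eq => x _; rewrite /patch in_setX (negPf yB) andbF.
Qed.
End fubini_rectangle.

Section slices.
Context {R : realType}.
Local Notation RT := (measurableTypeR R).

Definition cons_row n (x : R) (y : 'rV[R]_n) : 'rV[R]_n.+1 :=
  \row_i oapp (y 0) x (unlift ord0 i).

Lemma cons_row0 n x (y : 'rV[R]_n) : cons_row x y 0 ord0 = x.
Proof. by rewrite mxE unlift_none. Qed.

Lemma cons_row_lift n x (y : 'rV[R]_n) j : cons_row x y 0 (lift ord0 j) = y 0 j.
Proof. by rewrite mxE liftK. Qed.

Lemma cons_rowP n (z : 'rV[R]_n.+1) (x : R) (y : 'rV[R]_n) :
  z 0 ord0 = x -> (forall j, z 0 (lift ord0 j) = y 0 j) -> z = cons_row x y.
Proof.
move=> z0 zj; apply/rowP => i; case: (unliftP ord0 i) => [j ->|->].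
  by rewrite cons_row_lift.
by rewrite cons_row0.
Qed.

Lemma row_of_cons n (x : R) (t : n.-tuple RT) :
  row_of (tuple_cons (x, t)) = cons_row x (row_of t).
Proof. by apply: cons_rowP => [|j]; rewrite !mxE ?tnthS. Qed.

Lemma continuous_cons_row n (x : R) : continuous (@cons_row n x).
Proof.
apply: continuous_mx => i j; rewrite (ord1 i); case: (unliftP ord0 j) => [k ->|->].
  by under eq_fun do rewrite cons_row_lift; exact: coord_continuous.
by under eq_fun do rewrite cons_row0; exact: cst_continuous.
Qed.

Lemma continuous_cons_row_head n (y : 'rV[R]_n) : continuous (fun x => cons_row x y).
Proof.
apply: continuous_mx => i j; rewrite (ord1 i); case: (unliftP ord0 j) => [k ->|->].
  by under eq_fun do rewrite cons_row_lift; exact: cst_continuous.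
by under eq_fun do rewrite cons_row0; move=> x; exact: cvg_id.
Qed.

Let phi n := @tuple_cons R n.

Let preimage_unit_cube n : @phi n @^-1` unit_cube = `[0, 1]%classic `*` unit_cube.
Proof.
apply/seteqP; split=> -[x t] /=.
  by move=> tc; split=> [|i]; [exact: (tc ord0)|have := tc (lift ord0 i); rewrite tnthS].
by move=> [x01 tc] i; case: (unliftP ord0 i) => [j ->|->//]; rewrite tnthS; exact: tc.
Qed.

(** Both orders of integration serve the induction on the dimension: a derivative in the first
    coordinate has to be integrated in that coordinate first, any other one in the remaining
    coordinates first. *)
Lemma torus_integral_cons n (f : 'rV[R]_n.+1 -> R) : continuous f ->
  ((torus_integral f)%:E =
   \int[lebesgue_measure]_(x in `[0%R, 1%R]) \int[lebesgue_tuple n]_(t in unit_cube)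
      (f (cons_row x (row_of t)))%:E)%E /\
  ((torus_integral f)%:E =
   \int[lebesgue_tuple n]_(t in unit_cube) \int[lebesgue_measure]_(x in `[0%R, 1%R])
      (f (cons_row x (row_of t)))%:E)%E.
Proof.
move=> cf; pose g (z : RT * n.-tuple RT) := (f (row_of (phi z)))%:E.
have mf : measurable_fun [set: n.+1.-tuple RT] (EFin \o (f \o row_of)).
  by apply/measurable_EFinP; exact: measurable_continuous_row.
have ig : (lebesgue_measure \x lebesgue_tuple n)%E.-integrable (@phi n @^-1` unit_cube) g.
  have fin : ((lebesgue_measure \x lebesgue_tuple n)%E (@phi n @^-1` unit_cube) < +oo)%E.
    have := @lebesgue_tuple_cube R n.+1; rewrite /= /lebesgue_tuple_step /pushforward => ->.
    exact: ltry.
  apply: measurable_bounded_integrable => //.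
  - rewrite -[X in measurable X]setTI; apply: measurable_tuple_cons => //.
    exact: measurable_unit_cube.
  - apply: measurable_funTS.
    exact: (measurableT_comp (measurable_continuous_row cf) (@measurable_tuple_cons R n)).
  have [M HM] := continuous_bounded_on cf (@compact_cube R n.+1).
  exists M; split; first exact: num_real.
  by move=> x Mx t tc /=; apply: le_trans (ltW Mx); exact/HM/row_of_cube.
have E : (torus_integral f)%:E =
    (\int[lebesgue_measure \x lebesgue_tuple n]_(z in `[0%R, 1%R] `*` unit_cube) g z)%E.
  rewrite -torus_integralE// -preimage_unit_cube.
  have := @integral_pushforward _ _ _ _ _ (@phi n) (@measurable_tuple_cons R n)
    (lebesgue_measure \x lebesgue_tuple n)%E unit_cube (EFin \o (f \o row_of)) mf ig
    (@measurable_unit_cube R n.+1).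
  by [].
rewrite preimage_unit_cube in ig; have mC := @measurable_unit_cube R n.
have mI : measurable (`[0, 1]%classic : set RT) by exact: measurable_itv.
split; rewrite E.
  rewrite (fubini_rect12 mI mC ig).
  by apply: eq_integral => x _; apply: eq_integral => t _; rewrite /g row_of_cons.
rewrite (fubini_rect21 mI mC ig).
by apply: eq_integral => x _; apply: eq_integral => t _; rewrite /g row_of_cons.
Qed.

Lemma cons_row_delta_lift n (h x : R) (y : 'rV[R]_n) j :
  h *: delta_mx 0 (lift ord0 j) + cons_row x y = cons_row x (h *: delta_mx 0 j + y).
Proof.
apply: cons_rowP => [|k].
  by rewrite mxE cons_row0 !mxE /= mulr0 add0r.
by rewrite mxE cons_row_lift !mxE eqxx (inj_eq lift_inj).
Qed.

Lemma cons_row_delta0 n (h x : R) (y : 'rV[R]_n) :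
  h *: delta_mx 0 ord0 + cons_row x y = cons_row (h + x) y.
Proof.
apply: cons_rowP => [|k].
  by rewrite mxE cons_row0 !mxE /= mulr1.
by rewrite mxE cons_row_lift !mxE /= mulr0 add0r.
Qed.

(** Along the first coordinate this is the fundamental theorem of calculus with equal end values;
    along any other one the slices at fixed first coordinate fall under the induction hypothesis.
    Invariance is asked in the direction [i] only and [f'] is a separate function, so all hypotheses
    pass to slices. *)
Lemma torus_integral_derivative n (i : 'I_n) (f f' : 'rV[R]_n -> R) :
  continuous f -> continuous f' ->
  (forall y, is_derive y (delta_mx 0 i) f (f' y)) ->
  (forall y, f (delta_mx 0 i + y) = f y) ->
  torus_integral f' = 0.
Proof.
elim: n i f f' => [[]//|n IH] i f f' cf cf' df pf.
have [E1 E2] := torus_integral_cons cf'.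
case: (unliftP ord0 i) df pf => [j ->|->] df pf.
  suff : (torus_integral f')%:E = 0%E by case.
  rewrite E1 integral0_eq// => x _.
  have cs : continuous (fun y => f' (cons_row x y)).
    by move=> y; apply: continuous_comp; [exact: continuous_cons_row|exact: cf'].
  rewrite (torus_integralE cs); congr EFin.
  apply: (IH j (fun y => f (cons_row x y))) => //.
  - by move=> y; apply: continuous_comp; [exact: continuous_cons_row|exact: cf].
  - move=> y; have [d1 d2] := df (cons_row x y).
    have E : (fun h : R => h^-1 *: ((f \o shift (cons_row x y)) (h *: delta_mx 0 (lift ord0 j)) - f (cons_row x y))) =
        (fun h : R => h^-1 *: (((fun y => f (cons_row x y)) \o shift y) (h *: delta_mx 0 j) - f (cons_row x y))).
      by apply/funext => h /=; rewrite cons_row_delta_lift.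
    by split; [move: d1|rewrite -d2]; rewrite /derivable /derive E.
  - move=> y; rewrite -[RHS]pf -[delta_mx 0 j]scale1r -cons_row_delta_lift.
    by rewrite scale1r.
suff : (torus_integral f')%:E = 0%E by case.
rewrite E2 integral0_eq// => t _; set y := row_of t.
have ds (x : R) : is_derive x 1 (fun x : R => f (cons_row x y)) (f' (cons_row x y)).
  have [d1 d2] := df (cons_row x y).
  have E : (fun h : R => h^-1 *: ((f \o shift (cons_row x y)) (h *: delta_mx 0 ord0) - f (cons_row x y))) =
      (fun h : R => h^-1 *: (((fun x => f (cons_row x y)) \o shift x) (h *: 1) - f (cons_row x y))).
    by apply/funext => h /=; rewrite cons_row_delta0 [h *: 1]mulr1.
  by split; [move: d1|rewrite -d2]; rewrite /derivable /derive E.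
have cF (h : 'rV[R]_n.+1 -> R) : continuous h -> continuous (fun x => h (cons_row x y)).
  by move=> ch x; apply: continuous_comp; [exact: continuous_cons_row_head|exact: ch].
rewrite (@continuous_FTC2 _ (fun x => f' (cons_row x y)) (fun x => f (cons_row x y)))//.
- rewrite -EFinB; congr EFin; apply/eqP; rewrite subr_eq0; apply/eqP.
  by rewrite -[RHS]pf -[delta_mx 0 ord0]scale1r cons_row_delta0 addr0.
- by apply: continuous_subspaceT; exact: cF.
- split.
  + by move=> x _; exact: (@ex_derive _ _ _ _ _ _ _ (ds x)).
  + by apply: cvg_at_right_filter; exact: (cF _ cf).
  + by apply: cvg_at_left_filter; exact: (cF _ cf).
- by move=> x _; rewrite derive1E; exact: (@derive_val _ _ _ _ _ _ _ (ds x)).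
Qed.

Lemma torus_integral_partial n (i : 'I_n) (f : 'rV[R]_n -> R) :
  smooth_periodic f -> torus_integral (partial i f) = 0.
Proof.
move=> [sf pf]; apply: (@torus_integral_derivative _ i f).
- exact: smooth_continuous.
- exact/smooth_continuous/smooth_partial.
- by move=> y; exact/derivableP/smooth_derivable.
- move=> y; rewrite -[RHS](pf (delta_mx 0 i)) addrC; congr (f (_ + _)).
  by apply/matrixP => k l; rewrite !mxE; case: (_ && _).
Qed.

Lemma torus_integral_by_parts n (i : 'I_n) (f g : 'rV[R]_n -> R) :
  smooth_periodic f -> smooth_periodic g ->
  torus_integral (fun y => f y * partial i g y) =
  - torus_integral (fun y => partial i f y * g y).
Proof.
move=> [sf pf] [sg pg].
have spfg : smooth_periodic (fun y => f y * g y).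
  by split; [exact: (algM smooth_algebra)|move=> k y; rewrite pf pg].
have c1 : continuous (fun y => partial i f y * g y).
  exact: (smooth_continuous (algM smooth_algebra (smooth_partial i sf) sg)).
have c2 : continuous (fun y => f y * partial i g y).
  exact: (smooth_continuous (algM smooth_algebra sf (smooth_partial i sg))).
have := torus_integral_partial i spfg; rewrite (partialM i sf sg) torus_integralD//.
by move=> /eqP; rewrite addrC addr_eq0 => /eqP.
Qed.
End slices.

(** * Complex matrices as real ones *)

#[local] Opaque mulmx invmx determinant.

Section realification.
Local Open Scope complex_scope.
Context {R : realType} {n : nat}.
Local Notation C := R[i].
Implicit Types Z W : 'M[C]_n.

Definition Remx Z : 'M[R]_n := map_mx (@complex.Re R) Z.
Definition Immx Z : 'M[R]_n := map_mx (@complex.Im R) Z.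
Definition adjmx Z : 'M[C]_n := map_mx conjc Z^T.

Definition realify Z : 'M[R]_(n + n) :=
  block_mx (Remx Z) (Immx Z) (- Immx Z) (Remx Z).

Lemma Re_sum I (r : seq I) (F : I -> C) :
  complex.Re (\sum_(i <- r) F i) = \sum_(i <- r) complex.Re (F i).
Proof. by apply: (big_morph (@complex.Re R)) => [[a b] [c d]|]. Qed.

Lemma Im_sum I (r : seq I) (F : I -> C) :
  complex.Im (\sum_(i <- r) F i) = \sum_(i <- r) complex.Im (F i).
Proof. by apply: (big_morph (@complex.Im R)) => [[a b] [c d]|]. Qed.

Lemma RemxM Z W : Remx (Z *m W) = Remx Z *m Remx W - Immx Z *m Immx W.
Proof.
apply/matrixP => i j; rewrite !mxE Re_sum -sumrB; apply: eq_bigr => k _.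
by rewrite !mxE; case: (Z i k) (W k j) => [a b] [c d].
Qed.

Lemma ImmxM Z W : Immx (Z *m W) = Remx Z *m Immx W + Immx Z *m Remx W.
Proof.
apply/matrixP => i j; rewrite !mxE Im_sum -big_split; apply: eq_bigr => k _.
by rewrite !mxE; case: (Z i k) (W k j) => [a b] [c d].
Qed.

Lemma realifyM Z W : realify (Z *m W) = realify Z *m realify W.
Proof.
rewrite /realify mulmx_block RemxM ImmxM !mulNmx !mulmxN; congr block_mx.
- by rewrite opprD addrC.
- by rewrite addrC.
Qed.

Lemma realifyD Z W : realify (Z + W) = realify Z + realify W.
Proof.
rewrite /realify add_block_mx -opprD; congr block_mx;
  try congr (- _); apply/matrixP => i j; rewrite !mxE;
  by case: (Z i j) (W i j) => [a b] [c d].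
Qed.

Lemma realifyN Z : realify (- Z) = - realify Z.
Proof.
rewrite /realify opp_block_mx; congr block_mx;
  try congr (- _); apply/matrixP => i j; rewrite !mxE; by case: (Z i j).
Qed.

Lemma realifyB Z W : realify (Z - W) = realify Z - realify W.
Proof. by rewrite realifyD realifyN. Qed.

Lemma realifyZ (a : R) Z : realify (a%:C *: Z) = a *: realify Z.
Proof.
rewrite /realify scale_block_mx scalerN; congr block_mx;
  try congr (- _); apply/matrixP => i j; rewrite !mxE;
  by case: (Z i j) => x y /=; ring.
Qed.

Lemma realify_complexify (G : 'M[R]_n) :
  realify (complexify G) = block_mx G 0 0 G.
Proof.
by rewrite /realify /complexify; congr block_mx; apply/matrixP => i j; rewrite !mxE ?oppr0.
Qed.

Lemma realify1 : realify 1%:M = 1%:M.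
Proof.
rewrite [RHS]scalar_mx_block -realify_complexify; congr realify.
by rewrite /complexify map_scalar_mx.
Qed.

Lemma realify_adj Z : realify (adjmx Z) = (realify Z)^T.
Proof.
rewrite /realify tr_block_mx; congr block_mx; apply/matrixP => i j; rewrite !mxE;
  case: (Z j i) => x y //=.
by rewrite opprK.
Qed.

(** Complex conjugation as a real linear involution of the doubled space. *)
Definition conj_sgn : 'M[R]_(n + n) := block_mx 1%:M 0 0 (- 1%:M).

Lemma conj_sgnK : conj_sgn *m conj_sgn = 1%:M.
Proof.
rewrite /conj_sgn mulmx_block !mulmx0 !mul0mx !addr0 !add0r mulmxN mulNmx opprK !mulmx1.
by rewrite -scalar_mx_block.
Qed.

Lemma conj_sgn_tr : conj_sgn^T = conj_sgn.
Proof. by rewrite /conj_sgn tr_block_mx !trmx0 linearN/= !trmx1. Qed.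

Lemma realify_conj Z : realify (map_mx conjc Z) = conj_sgn *m realify Z *m conj_sgn.
Proof.
rewrite /conj_sgn /realify !mulmx_block !mulmx0 !mul0mx !addr0 !add0r.
rewrite !mulmxN !mulNmx !mulmx1 !mul1mx !opprK; congr block_mx;
  apply/matrixP => i j; rewrite !mxE; case: (Z i j) => x y //=.
by rewrite opprK.
Qed.

Lemma realify_unit Z : Z \in unitmx -> realify Z \in unitmx.
Proof.
move=> uZ; suff /mulmx1_unit[] : realify Z *m realify (invmx Z) = 1%:M by [].
by rewrite -realifyM mulmxV// realify1.
Qed.

Lemma realify_inv Z : Z \in unitmx -> realify (invmx Z) = invmx (realify Z).
Proof.
move=> uZ; apply: (can_inj (mulKmx (realify_unit uZ))).
by rewrite -realifyM !mulmxV ?realify1// realify_unit.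
Qed.

Lemma realify_inj : injective realify.
Proof.
move=> Z W /eq_block_mx[/matrixP RE /matrixP IM _ _]; apply/matrixP => i j.
have := RE i j; have := IM i j; rewrite !mxE.
by case: (Z i j) (W i j) => a b [c d] /= -> ->.
Qed.

Lemma mxtrace_realify Z : \tr (realify Z) = 2 * \tr (Remx Z).
Proof. by rewrite /realify mxtrace_block mulr2n mulrDl mul1r. Qed.

Lemma adjmxK Z : adjmx (adjmx Z) = Z.
Proof. by apply/matrixP => i j; rewrite !mxE conjcK. Qed.

Lemma adjmxM Z W : adjmx (Z *m W) = adjmx W *m adjmx Z.
Proof. by rewrite /adjmx trmx_mul map_mxM. Qed.

Lemma adjmx_complexify (G : 'M[R]_n) : adjmx (complexify G) = complexify G^T.
Proof. by apply/matrixP => i j; rewrite !mxE /= oppr0. Qed.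

Lemma complexifyM (G H : 'M[R]_n) : complexify (G *m H) = complexify G *m complexify H.
Proof. exact: map_mxM. Qed.

Lemma complexify1 : complexify (1%:M : 'M[R]_n) = 1%:M.
Proof. exact: map_mx1. Qed.

Local Notation cdiag e := (complexify (diag_mx e)).

Lemma hermitian_spectral Z : adjmx Z = Z ->
  exists V (e : 'rV[R]_n), V *m adjmx V = 1%:M /\ Z = adjmx V *m cdiag e *m V.
Proof.
move=> hZ; have Zh : Z \is hermsymmx.
  by apply/is_hermitianmxP; rewrite expr0 scale1r -{1}hZ.
have /orthomx_spectralP ZE := hermitian_normalmx Zh.
have /mxOverP rD := hermitian_spectral_diag_real Zh.
have uV := spectral_unitarymx Z.
exists (spectralmx Z), (\row_i complex.Re (spectral_diag Z 0 i)); split.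
  exact/unitarymxP.
rewrite {1}ZE (invmx_unitary uV); congr (mulmx (mulmx _ _) _).
rewrite /complexify map_diag_mx; congr diag_mx.
by apply/rowP => i; rewrite !mxE; exact/esym/RRe_real.
Qed.

Lemma unitary_unit V : V *m adjmx V = 1%:M -> V \in unitmx /\ adjmx V = invmx V.
Proof.
move=> VV; have [uV _] := mulmx1_unit VV; split => //.
by rewrite -[LHS](mulKmx uV) VV mulmx1.
Qed.

(** Under [realify] the unitary conjugation is a real congruence, and the diagonal matrix appears as
    two equal diagonal blocks. *)
Lemma spectral_posdef V (e : 'rV[R]_n) : V *m adjmx V = 1%:M ->
  posdefmx (realify (adjmx V *m cdiag e *m V)) <-> forall i, 0 < e 0 i.
Proof.
move=> VV; have [uV VE] := unitary_unit VV.
have uaV : adjmx V \in unitmx by rewrite VE unitmx_inv.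
have {2}-> : V = adjmx (adjmx V) by rewrite adjmxK.
rewrite !realifyM [realify (adjmx (adjmx V))]realify_adj realify_complexify.
rewrite -posdef_diag -(posdef_block (diag_mx e)); split.
  by apply: posdef_congr_unit; exact: realify_unit.
by apply: posdef_congr; rewrite row_free_unit realify_unit.
Qed.

Lemma cdiagM (e f : 'rV[R]_n) :
  cdiag e *m cdiag f = cdiag (\row_i (e 0 i * f 0 i)).
Proof.
rewrite -complexifyM mul_diag_mx; congr complexify.
by apply/matrixP => i j; rewrite !mxE mulrnAr.
Qed.

Lemma unitary_conjM V Z W : V *m adjmx V = 1%:M ->
  (adjmx V *m Z *m V) *m (adjmx V *m W *m V) = adjmx V *m (Z *m W) *m V.
Proof. by move=> VV; rewrite !mulmxA -[_ *m V *m adjmx V]mulmxA VV mulmx1. Qed.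

Lemma hermitian_sqrt Z : adjmx Z = Z -> posdefmx (realify Z) ->
  exists F, [/\ adjmx F = F, F *m F = Z & posdefmx (realify F)].
Proof.
move=> /hermitian_spectral[V [e [VV ->]]] /(spectral_posdef e VV) e0.
exists (adjmx V *m cdiag (\row_i Num.sqrt (e 0 i)) *m V); split.
- by rewrite !adjmxM adjmxK adjmx_complexify tr_diag_mx mulmxA.
- rewrite (unitary_conjM _ _ VV) cdiagM; set w := \row_i _.
  suff -> : w = e by reflexivity.
  by apply/rowP => i; rewrite !mxE -expr2 sqr_sqrtr ?ltW.
- by apply/(spectral_posdef _ VV) => i; rewrite mxE sqrtr_gt0.
Qed.

(** Chosen by its defining properties, with value 0 when no such root exists; all later use goes
    through [msqrtP]. *)
Definition msqrt Z : 'M[C]_n :=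
  xget 0 [set F | [/\ adjmx F = F, F *m F = Z & posdefmx (realify F)]].

Lemma msqrtP Z : adjmx Z = Z -> posdefmx (realify Z) ->
  [/\ adjmx (msqrt Z) = msqrt Z, msqrt Z *m msqrt Z = Z & posdefmx (realify (msqrt Z))].
Proof. by move=> hZ pZ; have [F PF] := hermitian_sqrt hZ pZ; rewrite /msqrt; case: xgetP => [y _|/(_ F)/(_ PF)]. Qed.

End realification.

Notation cdiag e := (complexify (diag_mx e)).

(** * Functions of diagonalisable matrices with real spectrum *)

Section diagonalizable.
Local Open Scope complex_scope.
Context {R : realType} {n : nat}.
Local Notation C := R[i].
Variables (U : 'M[C]_n) (d : 'rV[R]_n).
Hypothesis uU : U \in unitmx.
Let A : 'M[C]_n := invmx U *m cdiag d *m U.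

Lemma similarM (Z W : 'M[C]_n) :
  (invmx U *m Z *m U) *m (invmx U *m W *m U) = invmx U *m (Z *m W) *m U.
Proof. by rewrite !mulmxA mulmxK. Qed.

Lemma char_poly_similar : char_poly A = \prod_i ('X - (d 0 i)%:C%:P).
Proof.
have -> : char_poly A = char_poly (cdiag d).
  pose u := map_mx polyC U; pose v := map_mx polyC (invmx U).
  have vu : v *m u = 1%:M by rewrite -map_mxM mulVmx// map_mx1.
  rewrite /char_poly /char_poly_mx /A !map_mxM -/u -/v.
  have -> : 'X%:M - v *m map_mx polyC (cdiag d) *m u =
      v *m ('X%:M - map_mx polyC (cdiag d)) *m u.
    by rewrite mulmxBr mulmxBl (scalar_mxC 'X v) -[_ *m v *m u]mulmxA vu mulmx1.
  by rewrite !det_mulmx mulrAC -det_mulmx vu det1 mul1r.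
rewrite char_poly_trig.
  by apply: eq_bigr => i _; rewrite !mxE eqxx mulr1n.
by apply/is_trig_mxP => i j ij; rewrite !mxE (_ : _ == _ = false)// -val_eqE ltn_eqF.
Qed.

Lemma eigenvalues_similar :
  perm_eq (eigenvalues A) [seq (d 0 i)%:C | i <- index_enum 'I_n].
Proof.
rewrite /eigenvalues; case: closed_field_poly_normal => s /= sE.
apply: prod_XsubC_eq.
by move: sE; rewrite (monicP (char_poly_monic _)) scale1r char_poly_similar big_map.
Qed.

Lemma mem_eigenvalues (z : C) :
  (z \in eigenvalues A) <-> exists i, z = (d 0 i)%:C.
Proof.
rewrite (perm_mem eigenvalues_similar); split=> [/mapP[i _ ->]|[i ->]].
  by exists i.
by apply/mapP; exists i; rewrite // mem_index_enum.
Qed.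

Lemma spectral_radius_similar :
  spectral_radius A < 1 <-> forall i, `|d 0 i| < 1.
Proof.
have nE (a : R) : Normc.normc a%:C = `|a|.
  by rewrite /= expr0n /= addr0 sqrtr_sqr.
rewrite /spectral_radius; split=> [r1 i|d1].
  rewrite -nE; apply: le_lt_trans r1; apply: le_bigmax_seq => //.
  by apply/mem_eigenvalues; exists i.
rewrite big_seq; apply: bigmax_lt => // z /mem_eigenvalues[i ->].
by rewrite nE.
Qed.

Lemma sum_eigenvalues (f : C -> R) :
  \sum_(z <- eigenvalues A) f z = \sum_i f (d 0 i)%:C.
Proof. by rewrite (perm_big _ eigenvalues_similar) big_map. Qed.

Lemma similar_prod (r : seq C) (P : pred C) (a b : C -> C) :
  \big[mulmx/1%:M]_(m <- r | P m) (a m *: (A - (b m)%:M)) =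
  invmx U *m diag_mx (\row_i \prod_(m <- r | P m) (a m * ((d 0 i)%:C - b m))) *m U.
Proof.
elim: r => [|m r IH].
  rewrite big_nil (_ : \row_i _ = const_mx 1).
    by rewrite diag_const_mx mulmx1 mulVmx.
  by apply/rowP => i; rewrite !mxE big_nil.
rewrite big_cons; case: ifPn => Pm; last first.
  rewrite IH; set v := \row_i _; set w := \row_i _.
  suff -> : v = w by reflexivity.
  by apply/rowP => i; rewrite [LHS]mxE [RHS]mxE big_cons (negPf Pm).
rewrite IH.
have -> : a m *: (A - (b m)%:M) =
    invmx U *m diag_mx (\row_i (a m * ((d 0 i)%:C - b m))) *m U.
  have -> : diag_mx (\row_i (a m * ((d 0 i)%:C - b m))) =
      a m *: (cdiag d - (b m)%:M).
    by apply/matrixP => i j; rewrite !mxE; case: eqVneq => [->|]/=;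
      rewrite ?mulr1n ?mulr0n ?subr0 ?mulr0.
  rewrite -scalemxAr -scalemxAl mulmxBr mulmxBl -/A; congr (_ *: (_ - _)).
  by rewrite (scalar_mxC (b m) (invmx U)) -mulmxA mulVmx// mulmx1.
rewrite similarM mulmx_diag; set v := \row_i (_ * _); set w := \row_i _.
suff -> : v = w by reflexivity.
by apply/rowP => i; rewrite [LHS]mxE [RHS]mxE [X in X * _ = _]mxE [X in _ * X = _]mxE big_cons Pm.
Qed.

(** At the diagonal position [i] the factor [m = d 0 i] annihilates every summand with [l != d 0 i],
    while for [l = d 0 i] all factors equal 1. *)
Lemma matrix_fun_similar (f : R -> R) :
  matrix_fun f A = invmx U *m cdiag (\row_i f (d 0 i)) *m U.
Proof.
rewrite /matrix_fun.
under eq_bigr do rewrite similar_prod scalemxAl scalemxAr.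
rewrite -mulmx_suml -mulmx_sumr; congr (_ *m _ *m _).
apply/matrixP => i j; rewrite summxE !mxE; case: (eqVneq i j) => [<-{j}|ij]; last first.
  by rewrite big1// => l _; rewrite !mxE (negPf ij) mulr0n mulr0.
have di : (d 0 i)%:C \in undup (eigenvalues A).
  by rewrite mem_undup; apply/mem_eigenvalues; exists i.
rewrite (bigD1_seq _ di) ?undup_uniq//= [X in _ + X]big1 ?addr0.
  rewrite !mxE eqxx !mulr1n big1 ?mulr1// => m mi.
  by rewrite mulVf// subr_eq0 eq_sym.
move=> l li; rewrite !mxE eqxx mulr1n; apply/eqP; rewrite mulf_eq0 prodf_seq_eq0.
apply/orP; right; apply/hasP; exists (d 0 i)%:C => //=.
by rewrite subrr mulr0 eqxx andbT eq_sym.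
Qed.
End diagonalizable.

#[local] Opaque msqrt.

Section conjugation.
Context {F : comUnitRingType} {n : nat}.
Variables P X Y : 'M[F]_n.
Hypothesis uP : P \in unitmx.

Lemma conj_sandwich : X *m (P *m P) *m Y *m (P *m P) =
  invmx P *m ((P *m X *m P) *m (P *m Y *m P)) *m P.
Proof. by rewrite !mulmxA mulVmx// mul1mx. Qed.

Lemma sandwichB : P *m P - (P *m P) *m X *m (P *m P) *m Y *m (P *m P) =
  P *m (1%:M - (P *m X *m P) *m (P *m Y *m P)) *m P.
Proof. by rewrite mulmxBr mulmxBl mulmx1 !mulmxA. Qed.

Lemma conj_oneB : 1%:M - invmx P *m X *m P = invmx P *m (1%:M - X) *m P.
Proof. by rewrite mulmxBr mulmxBl mulmx1 mulVmx. Qed.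

Lemma conj_oneD : 1%:M + invmx P *m X *m P = invmx P *m (1%:M + X) *m P.
Proof. by rewrite mulmxDr mulmxDl mulmx1 mulVmx. Qed.

Lemma conj_mulmx : Y \in unitmx ->
  invmx P *m (invmx Y *m X *m Y) *m P = invmx (Y *m P) *m X *m (Y *m P).
Proof.
move=> uY; suff -> : invmx (Y *m P) = invmx P *m invmx Y by rewrite !mulmxA.
have uYP : Y *m P \in unitmx by rewrite unitmx_mul uY.
apply: (can_inj (mulKmx uYP)).
by rewrite mulmxV ?unitmx_mul ?uY// mulmxA mulmxK// mulmxV.
Qed.

Lemma conjmxZ (x : F) : invmx P *m (x *: X) *m P = x *: (invmx P *m X *m P).
Proof. by rewrite -scalemxAr -scalemxAl. Qed.

Lemma intertwine_conj Q Q' : Q *m (P *m X *m P) = P *m X *m P *m Q' ->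
  invmx P *m Q *m P *m X *m (P *m P) = X *m (P *m P) *m (invmx P *m Q' *m P).
Proof.
rewrite !mulmxA => QX; apply: (can_inj (mulKmx uP)).
by rewrite !mulmxA mulmxV// mul1mx QX mulmxK.
Qed.

End conjugation.

(** Both [Q^2 X] and [X Q'^2] equal [X - X Y X], and the mixed terms [Q X Q'] cancel. *)
Lemma sqr_intertwine (F : comUnitRingType) (n : nat) (Q Q' X Y : 'M[F]_n) :
  Q *m Q = 1%:M - X *m Y -> Q' *m Q' = 1%:M - Y *m X ->
  Q *m (Q *m X - X *m Q') + (Q *m X - X *m Q') *m Q' = 0.
Proof.
move=> QQ QQ'; rewrite mulmxBr mulmxBl [Q *m (X *m Q')]mulmxA addrA subrK.
rewrite mulmxA QQ -[X *m Q' *m Q']mulmxA QQ' mulmxBl mulmxBr mul1mx mulmx1 mulmxA.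
by rewrite subrr.
Qed.

Lemma ln_prod (R : realType) n (F : 'I_n -> R) : (forall i, 0 < F i) ->
  ln (\prod_i F i) = \sum_i ln (F i).
Proof.
move=> F0; elim: n F F0 => [|n IH] F F0; first by rewrite !big_ord0 ln1.
rewrite !big_ord_recl lnM ?posrE ?IH//.
by apply: prodr_gt0 => i _.
Qed.

Lemma realify0 (R : realType) n : realify (0 : 'M[R[i]]_n) = 0.
Proof. by rewrite -[RHS](subrr (realify 0)) -realifyB subr0. Qed.

Lemma mulmx_tr_ge0 (R : realDomainType) (m n : nat) (M : 'M[R]_(m, n)) i :
  0 <= (M *m M^T) i i.
Proof. by rewrite mxE sumr_ge0// => k _; rewrite mxE -expr2 sqr_ge0. Qed.

Lemma mulmx_regroup (F : comUnitRingType) (n : nat) (A B C D : 'M[F]_n) :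
  A *m (B *m C) *m D = (A *m B) *m (C *m D).
Proof. by rewrite !mulmxA. Qed.

Lemma psi_oneB_sqr (R : realType) (q : R) : 0 < q -> psi (1 - q ^+ 2) = 2^-1 * (1 + q)^-1.
Proof. by move=> q0; rewrite /psi subKr sqrtr_sqr gtr0_norm. Qed.

(** * Square roots attached to the metric and the Higgs tensor *)

Section kernel.
Local Open Scope complex_scope.
Context {R : realType} {n : nat}.
Local Notation C := R[i].
Variables (G : 'M[R]_n) (xi : 'M[C]_n).
Local Notation cG := (complexify G).

(* [Smx] is the square root of [1 - Amx] with positive spectrum, and
   [Nmx = cG (1 - Amx)] detects whether the spectral radius of [Amx] is [< 1]. *)
Definition Amx : 'M[C]_n := xi *m cG *m map_mx conjc xi *m cG.
Definition Pmx : 'M[C]_n := msqrt cG.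
Definition Xmx : 'M[C]_n := Pmx *m xi *m Pmx.
Definition Qmx : 'M[C]_n := msqrt (1%:M - Xmx *m adjmx Xmx).
Definition Smx : 'M[C]_n := invmx Pmx *m Qmx *m Pmx.
Definition Nmx : 'M[C]_n := cG - cG *m xi *m cG *m map_mx conjc xi *m cG.

Hypothesis pG : posdefmx G.
Hypothesis sxi : xi^T = xi.

Lemma PmxP : [/\ adjmx Pmx = Pmx, Pmx *m Pmx = cG & posdefmx (realify Pmx)].
Proof.
apply: msqrtP; first by rewrite adjmx_complexify pG.1.
by rewrite realify_complexify posdef_block.
Qed.

Lemma unit_realify (Z : 'M[C]_n) : realify Z \in unitmx -> Z \in unitmx.
Proof.
move=> uZ; rewrite -row_free_unit; apply: inj_row_free => x xZ.
(* [realify] takes square matrices, so the row vector [x] killed by [Z] is repeated [n] times. *)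
pose W := \matrix_(i < n) x.
have WZ : W *m Z = 0.
  by apply/row_matrixP => i; rewrite row_mul rowK xZ row0.
have : realify W *m realify Z = 0.
  by rewrite -realifyM WZ realify0.
move=> /(congr1 (mulmx^~ (invmx (realify Z)))); rewrite mulmxK// mul0mx.
move=> W0; have {}W0 : W = 0.
  by apply: realify_inj; rewrite W0 realify0.
apply/rowP => j; have /matrixP/(_ j j) := W0; by rewrite !mxE.
Qed.

Lemma Pmx_unit : Pmx \in unitmx.
Proof. by have [_ _ /posdef_unit/unit_realify] := PmxP. Qed.

Lemma adj_Xmx : adjmx Xmx = Pmx *m map_mx conjc xi *m Pmx.
Proof.
have [aP _ _] := PmxP.
by rewrite !adjmxM aP mulmxA; congr (_ *m _ *m _); rewrite /adjmx sxi.
Qed.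

Lemma XadjX_herm : adjmx (Xmx *m adjmx Xmx) = Xmx *m adjmx Xmx.
Proof. by rewrite adjmxM adjmxK. Qed.

Lemma adjmx1 : adjmx (1%:M : 'M[C]_n) = 1%:M.
Proof. by rewrite -complexify1 adjmx_complexify trmx1. Qed.

Lemma adjmxB (Z W : 'M[C]_n) : adjmx (Z - W) = adjmx Z - adjmx W.
Proof. by rewrite /adjmx linearB /= map_mxB. Qed.

Lemma Wmx_herm : adjmx (1%:M - Xmx *m adjmx Xmx) = 1%:M - Xmx *m adjmx Xmx.
Proof. by rewrite adjmxB adjmx1 XadjX_herm. Qed.

Lemma AmxE : Amx = invmx Pmx *m (Xmx *m adjmx Xmx) *m Pmx.
Proof.
have [_ PP _] := PmxP; have := conj_sandwich xi (map_mx conjc xi) Pmx_unit.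
by rewrite PP adj_Xmx.
Qed.

Lemma realify_Nmx : realify Nmx =
  realify Pmx *m realify (1%:M - Xmx *m adjmx Xmx) *m (realify Pmx)^T.
Proof.
have [aP PP _] := PmxP; rewrite -realify_adj aP -!realifyM; apply: f_equal.
by have := sandwichB Pmx xi (map_mx conjc xi); rewrite PP adj_Xmx.
Qed.

Lemma posdef_Nmx :
  posdefmx (realify Nmx) <-> posdefmx (realify (1%:M - Xmx *m adjmx Xmx)).
Proof.
have uP := realify_unit Pmx_unit.
rewrite realify_Nmx; split; first exact: posdef_congr_unit.
by apply: posdef_congr; rewrite row_free_unit.
Qed.

(** [Amx] is similar to [X X^*] and [Nmx] is congruent to [1 - X X^*], so with [e] the eigenvalues
    of [X X^*] one compares [|e| < 1] with [0 < 1 - e]. The gain is a condition polynomial in the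
    entries of [G] and [xi] and their conjugates, with no eigenvalues. *)
Lemma spectral_radius_posdef : spectral_radius Amx < 1 <-> posdefmx (realify Nmx).
Proof.
rewrite posdef_Nmx; have [V [e [VV XE]]] := hermitian_spectral XadjX_herm.
have [uV VE] := unitary_unit VV.
have uVP : V *m Pmx \in unitmx by rewrite unitmx_mul uV Pmx_unit.
have AE : Amx = invmx (V *m Pmx) *m cdiag e *m (V *m Pmx).
  by rewrite AmxE XE VE conj_mulmx// Pmx_unit.
rewrite AE (spectral_radius_similar _ uVP).
have WE : 1%:M - Xmx *m adjmx Xmx = adjmx V *m cdiag (\row_i (1 - e 0 i)) *m V.
  have -> : cdiag (\row_i (1 - e 0 i)) = 1%:M - cdiag e.
    apply/matrixP => i j; rewrite !mxE; case: (i == j) => //=.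
      by rewrite !mulr1n; apply/eqP; rewrite eq_complex /= subr0 !eqxx.
    by rewrite !mulr0n subr0.
  by rewrite {1}XE VE (conj_oneB _ uV).
rewrite WE (spectral_posdef _ VV).
(* After conjugation by [V] and realification, [e 0 i] is a diagonal entry of a product [M M^T]. *)
have e0 i : 0 <= e 0 i.
  have : V *m (Xmx *m adjmx Xmx) *m adjmx V = cdiag e.
    by rewrite XE VE !mulmxA mulmxV// mul1mx mulmxK.
  have -> : V *m (Xmx *m adjmx Xmx) *m adjmx V = (V *m Xmx) *m adjmx (V *m Xmx).
    by rewrite adjmxM mulmx_regroup.
  move=> /(congr1 realify); rewrite realifyM realify_adj realify_complexify.
  move=> /(congr1 (fun M : 'M[R]_(n + n) => M (lshift n i) (lshift n i))).
  rewrite block_mxEul [X in _ = X]mxE eqxx mulr1n => <-.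
  exact: mulmx_tr_ge0.
split=> h i; have := h i; rewrite ?mxE ger0_norm// ?subr_gt0//.
Qed.

Lemma map_conjM (Z W : 'M[C]_n) : map_mx conjc (Z *m W) = map_mx conjc Z *m map_mx conjc W.
Proof. exact: map_mxM. Qed.

Lemma conj_posdef (Z : 'M[C]_n) : posdefmx (realify Z) -> posdefmx (realify (map_mx conjc Z)).
Proof.
rewrite realify_conj -{2}conj_sgn_tr; apply: posdef_congr.
by rewrite row_free_unit; case/mulmx1_unit: (@conj_sgnK R n).
Qed.

(** [G] is real, so the conjugate of [Pmx] is also a positive definite root of [cG], and such roots
    are unique. *)
Lemma conj_Pmx : map_mx conjc Pmx = Pmx.
Proof.
have [aP PP pP] := PmxP; apply: realify_inj.
apply: posdef_sqr_inj => //; first exact: conj_posdef.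
rewrite -!realifyM -map_conjM PP; congr realify.
by apply/matrixP => i j; rewrite !mxE /= oppr0.
Qed.

Hypothesis rA : spectral_radius Amx < 1.

Lemma QmxP : [/\ adjmx Qmx = Qmx, Qmx *m Qmx = 1%:M - Xmx *m adjmx Xmx &
  posdefmx (realify Qmx)].
Proof.
apply: msqrtP; first exact: Wmx_herm.
exact: (proj1 posdef_Nmx (proj1 spectral_radius_posdef rA)).
Qed.

Lemma Smx_sqr : Smx *m Smx = 1%:M - Amx.
Proof.
have [_ QQ _] := QmxP.
by rewrite /Smx (similarM Pmx_unit) QQ AmxE (conj_oneB _ Pmx_unit).
Qed.

(** [U = V P], where [V] diagonalises [Q]. The eigenvalues of [Amx] come in the form [1 - q^2] with
    [q > 0], so that [sqrt (1 - d)] in [psi] and [H] is just [q]. *)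
Lemma Smx_diag : exists U (q : 'rV[R]_n), [/\ U \in unitmx, forall i, 0 < q 0 i,
  Smx = invmx U *m cdiag q *m U &
  Amx = invmx U *m cdiag (\row_i (1 - q 0 i ^+ 2)) *m U].
Proof.
have [aQ QQ pQ] := QmxP; have [V [q [VV QE]]] := hermitian_spectral aQ.
have [uV VE] := unitary_unit VV.
have uVP : V *m Pmx \in unitmx by rewrite unitmx_mul uV Pmx_unit.
have SE : Smx = invmx (V *m Pmx) *m cdiag q *m (V *m Pmx).
  by rewrite /Smx QE VE conj_mulmx// Pmx_unit.
exists (V *m Pmx), q; split; [exact: uVP| |exact: SE|].
  by apply/(spectral_posdef _ VV); rewrite -QE.
have -> : Amx = 1%:M - Smx *m Smx by rewrite Smx_sqr subKr.
rewrite SE (similarM uVP) cdiagM.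
have -> : cdiag (\row_i (1 - q 0 i ^+ 2)) = 1%:M - cdiag (\row_i (q 0 i * q 0 i)).
  apply/matrixP => i j; rewrite !mxE; case: (i == j) => //=.
    by rewrite !mulr1n -expr2; apply/eqP; rewrite eq_complex /= subr0 !eqxx.
  by rewrite !mulr0n subr0.
exact: conj_oneB.
Qed.

(** On an eigenvalue [1 - q^2] of [Amx], [psi] takes the value [(1 + q)^-1 / 2]. The right-hand side
    no longer refers to eigenvalues and is rational in [Smx]. *)
Lemma psi_Amx : 1%:M + Smx \in unitmx /\
  matrix_fun psi Amx = (2^-1 : R)%:C *: invmx (1%:M + Smx).
Proof.
have [U [q [uU q0 SE AE]]] := Smx_diag.
have S1 : 1%:M + Smx = invmx U *m cdiag (\row_i (1 + q 0 i)) *m U.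
  have -> : cdiag (\row_i (1 + q 0 i)) = 1%:M + cdiag q.
    apply/matrixP => i j; rewrite !mxE; case: (i == j) => //=.
      by rewrite !mulr1n; apply/eqP; rewrite eq_complex /= addr0 !eqxx.
    by rewrite !mulr0n addr0.
  by rewrite SE; exact: conj_oneD.
pose T := invmx U *m cdiag (\row_i (1 + q 0 i)^-1) *m U.
have ST : (1%:M + Smx) *m T = 1%:M.
  rewrite S1 /T (similarM uU) cdiagM.
  rewrite (_ : \row_i _ = const_mx 1); last first.
    by apply/rowP => i; rewrite !mxE divff// gt_eqF// ltr_pwDl// ltW.
  by rewrite diag_const_mx complexify1 mulmx1 (mulVmx uU).
have [uS _] := mulmx1_unit ST.
split => //; have -> : invmx (1%:M + Smx) = T by rewrite -[RHS](mulKmx uS) ST mulmx1.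
rewrite AE (matrix_fun_similar _ uU) /T -conjmxZ.
suff -> : cdiag (\row_i psi ((\row_i (1 - q 0 i ^+ 2)) 0 i)) =
  (2^-1 : R)%:C *: cdiag (\row_i (1 + q 0 i)^-1) by reflexivity.
apply/matrixP => i j; rewrite 3!mxE [RHS]mxE [in RHS]mxE [X in _ * real_complex _ X]mxE.
rewrite -rmorphM; apply: f_equal; case: (i == j); last by rewrite !mulr0n mulr0.
by rewrite !mulr1n !mxE psi_oneB_sqr.
Qed.

(* The factor [1/2] undoes the doubling of eigenvalues by [realify]. *)
Definition H_of_sqrt (M : 'M[R]_(n + n)) : R :=
  2^-1 * (\tr (1%:M - M) + ln (\det (2^-1 *: (1%:M + M)))).

Lemma H_of_sqrtE : 0 < \det (2^-1 *: (1%:M + realify Smx)) /\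
  \sum_(z <- eigenvalues Amx)
    (let d := complex.Re z in
     1 - Num.sqrt (1 - d) + ln ((1 + Num.sqrt (1 - d)) / 2)) = H_of_sqrt (realify Smx).
Proof.
have [U [q [uU q0 SE AE]]] := Smx_diag.
have rS : realify Smx = invmx (realify U) *m block_mx (diag_mx q) 0 0 (diag_mx q) *m realify U.
  by rewrite SE !realifyM realify_complexify realify_inv.
have ruU := realify_unit uU.
have trS : \tr (1%:M - realify Smx) = 2 * \sum_i (1 - q 0 i).
  rewrite linearB /= rS mxtrace_mulC mulmxA mulmxV// mul1mx mxtrace_block.
  rewrite mxtrace1 mxtrace_diag sumrB sumr_const card_ord natrD; ring.
have dE : \det (2^-1 *: (1%:M + realify Smx)) = (\prod_i ((1 + q 0 i) / 2)) ^+ 2.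
  rewrite rS (conj_oneD _ ruU) -conjmxZ !det_mulmx mulrAC -det_mulmx mulVmx// det1 mul1r.
  rewrite scalar_mx_block add_block_mx scale_block_mx !addr0 scaler0 det_ublock expr2.
  suff -> : 2^-1 *: (1%:M + diag_mx q) = diag_mx (\row_i ((1 + q 0 i) / 2)).
    by rewrite det_diag; under eq_bigr do rewrite mxE.
  apply/matrixP => i j; rewrite !mxE; case: (i == j); rewrite ?mulr1n ?mulr0n ?addr0 ?mulr0//.
  by rewrite mulrC.
have q2 i : 0 < (1 + q 0 i) / 2 by rewrite divr_gt0// ltr_pwDl// ltW.
have prod0 : 0 < \prod_i ((1 + q 0 i) / 2) by apply: prodr_gt0 => i _.
split; first by rewrite dE exprn_gt0.
have half (a b : R) : 2^-1 * (2 * a + b *+ 2) = a + b by field.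
rewrite /H_of_sqrt AE (sum_eigenvalues _ uU) trS dE lnXn// ln_prod//.
rewrite half -big_split/=; apply: eq_bigr => i _.
by rewrite mxE subKr sqrtr_sqr gtr0_norm.
Qed.

(** [X] is symmetric, so its conjugate is [X^*], and the conjugate of [Q] squares to [1 - X^* X].
    Hence [Q X - X conj(Q)] solves a homogeneous Sylvester equation with positive definite
    coefficients and vanishes; conjugating by [P] gives the claim. *)
Lemma Smx_intertwine : Smx *m xi *m cG = xi *m cG *m map_mx conjc Smx.
Proof.
have [_ QQ pQ] := QmxP; have [_ PP _] := PmxP.
have cX : map_mx conjc Xmx = adjmx Xmx.
  by rewrite adj_Xmx /Xmx !map_conjM conj_Pmx.
have cQQ : map_mx conjc Qmx *m map_mx conjc Qmx = 1%:M - adjmx Xmx *m Xmx.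
  rewrite -map_conjM QQ -cX map_mxB map_mx1 map_conjM -map_mx_comp.
  by rewrite [X in _ *m X]map_mx_id// => x /=; rewrite conjcK.
pose W := Qmx *m Xmx - Xmx *m map_mx conjc Qmx.
have W0 : Qmx *m W + W *m map_mx conjc Qmx = 0.
  by apply: (sqr_intertwine QQ cQQ).
have {W0} : realify W = 0.
  apply: (sylvester_inj pQ (conj_posdef pQ)).
  by rewrite -!realifyM -realifyD W0 realify0.
rewrite -[RHS]realify0 => /realify_inj/subr0_eq QX.
have cS : map_mx conjc Smx = invmx Pmx *m map_mx conjc Qmx *m Pmx.
  by rewrite /Smx !map_conjM map_invmx conj_Pmx.
rewrite cS -PP; exact: (intertwine_conj Pmx_unit QX).
Qed.

End kernel.

Section sandwich.
Context {F : fieldType} {n : nat}.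
Implicit Types P Q S X G : 'M[F]_n.

Lemma sandwich_sym P Q : P \in unitmx -> P^T = P -> Q^T = Q ->
  (invmx P *m Q *m P)^T *m (P *m P) = P *m P *m (invmx P *m Q *m P).
Proof.
move=> uP sP sQ; rewrite !trmx_mul trmx_inv sP sQ !mulmxA mulmxK//.
by rewrite mulmxKV.
Qed.

(** With [W = (1 + S)^-1] and [Y = X G X^T]: [W] commutes with [Y G = 1 - S^2], and [W^T G = G W].
    Therefore [Y W^T G = Y G W = W Y G], and [G] cancels. *)
Lemma moment_sym (a b : F) H G S X : H^T = H -> 1%:M + S \in unitmx -> G \in unitmx ->
  G^T = G -> S^T *m G = G *m S -> S *m S = 1%:M - X *m G *m X^T *m G ->
  (a *: H + b *: invmx (1%:M + S) *m (X *m G *m X^T))^T =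
  a *: H + b *: invmx (1%:M + S) *m (X *m G *m X^T).
Proof.
move=> sH uS uG sG SG SS; set W := invmx (1%:M + S).
have WS : W *m (X *m G *m X^T *m G) = X *m G *m X^T *m G *m W.
  have c : (1%:M + S) *m (X *m G *m X^T *m G) = X *m G *m X^T *m G *m (1%:M + S).
    have -> : X *m G *m X^T *m G = 1%:M - S *m S by rewrite SS subKr.
    by rewrite mulmxDl mulmxDr mul1mx mulmx1 mulmxBr mulmxBl mul1mx mulmx1 mulmxA.
  apply: (can_inj (mulKmx uS)); rewrite mulKVmx// mulmxA c mulmxK//.
have WG : W^T *m G = G *m W.
  have e : (1%:M + S)^T *m G = G *m (1%:M + S).
    by rewrite linearD /= trmx1 mulmxDl mulmxDr mul1mx mulmx1 SG.
  have WW : W^T *m (1%:M + S)^T = 1%:M by rewrite -trmx_mul mulmxV// trmx1.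
  by rewrite -[LHS](mulmxK uS) -/W -[_ *m G *m _]mulmxA -e !mulmxA WW mul1mx.
have sY : (X *m G *m X^T)^T = X *m G *m X^T by rewrite !trmx_mul trmxK sG mulmxA.
rewrite linearD /= linearZ /= sH; congr (_ + _).
rewrite trmx_mul sY linearZ /= -scalemxAr -scalemxAl; congr (_ *: _).
apply: (can_inj (mulmxK uG)); rewrite -[LHS]mulmxA WG mulmxA -WS.
by rewrite !mulmxA.
Qed.

End sandwich.

(** * The moment tensor at a point *)

Section moment.
Local Open Scope complex_scope.
Context {R : realType} {n : nat}.
Local Notation C := R[i].
Variables (G : 'M[R]_n) (xi : 'M[C]_n).
Local Notation cG := (complexify G).

(** [moment_tensor] at one point, as a function of two matrices; at [hessian u y] and [xi y] the two
    agree by conversion. *)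
Definition Tmx : 'M[C]_n :=
  - 2^-1 *: complexify (invmx G) + matrix_fun psi (Amx G xi) *m (xi *m cG *m map_mx conjc xi).

Hypothesis pG : posdefmx G.
Hypothesis sxi : xi^T = xi.
Hypothesis rA : spectral_radius (Amx G xi) < 1.

Lemma realify_conj_sym : realify (map_mx conjc xi) = (realify xi)^T.
Proof. by rewrite -realify_adj /adjmx sxi. Qed.

Lemma unit_one_plus_S : 1%:M + realify (Smx G xi) \in unitmx.
Proof.
have [uS _] := psi_Amx pG sxi rA.
by rewrite -realify1 -realifyD realify_unit.
Qed.

Lemma real_complexN2V : - 2^-1 = (- 2^-1 : R)%:C :> C.
Proof. by rewrite rmorphN /= fmorphV /= rmorph_nat. Qed.

Lemma realify_Tmx : realify Tmx = - 2^-1 *: realify (complexify (invmx G)) +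
  2^-1 *: invmx (1%:M + realify (Smx G xi)) *m
    (realify xi *m realify cG *m (realify xi)^T).
Proof.
have [uS pE] := psi_Amx pG sxi rA.
rewrite /Tmx realifyD real_complexN2V realifyZ pE realifyM realifyZ.
by rewrite (realify_inv uS) realifyD realify1 2!realifyM realify_conj_sym.
Qed.

Lemma realify_Amx : realify (Amx G xi) =
  realify xi *m realify cG *m (realify xi)^T *m realify cG.
Proof. by rewrite /Amx 3!realifyM realify_conj_sym. Qed.

Lemma realify_Smx_sqr : realify (Smx G xi) *m realify (Smx G xi) =
  1%:M - realify xi *m realify cG *m (realify xi)^T *m realify cG.
Proof. by rewrite -realifyM (Smx_sqr pG sxi rA) realifyB realify1 realify_Amx. Qed.

Lemma realify_cG_sym : (realify cG)^T = realify cG.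
Proof. by rewrite -realify_adj adjmx_complexify pG.1. Qed.

Lemma Smx_G_sym : (realify (Smx G xi))^T *m realify cG = realify cG *m realify (Smx G xi).
Proof.
have [aP PP _] := PmxP pG; have [aQ _ _] := QmxP pG sxi rA; have uP := Pmx_unit pG.
have sP : (realify (Pmx G))^T = realify (Pmx G) by rewrite -realify_adj aP.
have sQ : (realify (Qmx G xi))^T = realify (Qmx G xi) by rewrite -realify_adj aQ.
rewrite -PP realifyM /Smx 2!realifyM (realify_inv uP).
by rewrite (sandwich_sym (realify_unit uP) sP sQ).
Qed.

(** The real form of the statement that the moment tensor is Hermitian; its off-diagonal blocks
    carry the antisymmetry of the imaginary part. *)
Lemma realify_Tmx_sym : (realify Tmx)^T = realify Tmx.
Proof.
rewrite realify_Tmx realify_complexify; apply: moment_sym.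
- by rewrite tr_block_mx trmx0 trmx_inv pG.1.
- exact: unit_one_plus_S.
- rewrite realify_complexify; exact: (posdef_unit (proj2 (posdef_block G) pG)).
- exact: realify_cG_sym.
- exact: Smx_G_sym.
- exact: realify_Smx_sqr.
Qed.

End moment.

Lemma posdef_det (R : realType) n (G : 'M[R]_n) : posdefmx G -> 0 < \det G.
Proof.
move=> pG; have hG : adjmx (complexify G) = complexify G by rewrite adjmx_complexify pG.1.
have [V [e [VV GE]]] := hermitian_spectral hG.
have e0 : forall i, 0 < e 0 i.
  by apply/(spectral_posdef _ VV); rewrite -GE realify_complexify; apply/posdef_block.
have [uV VE] := unitary_unit VV.
have : \det (complexify G) = \det (complexify (diag_mx e)).
  by rewrite GE VE 2!det_mulmx mulrAC -det_mulmx mulVmx// det1 mul1r.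
rewrite /complexify !det_map_mx => /complexI ->.
by rewrite det_diag; apply: prodr_gt0 => i _.
Qed.

(** * Regularity of the roots and of the moment tensor in a parameter *)

Section family.
Context {R : realType} {n : nat} {T : Type}.
Local Notation C := R[i].
Variables (K : (T -> R) -> Prop).
Hypotheses (algK : function_algebra K) (sqrtK : sqrt_closed K).
Variables (G : T -> 'M[R]_n) (xi : T -> 'M[C]_n).
Hypothesis pG : forall p, posdefmx (G p).
Hypothesis sxi : forall p, (xi p)^T = xi p.
Hypothesis rA : forall p, spectral_radius (Amx (G p) (xi p)) < 1.
Hypothesis KG : entries_in K G.
Hypothesis KRe : forall a b, K (fun p => complex.Re (xi p a b)).
Hypothesis KIm : forall a b, K (fun p => complex.Im (xi p a b)).

Lemma entries_realify_xi : entries_in K (fun p => realify (xi p)).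
Proof.
have kR : entries_in K (fun p => Remx (xi p)).
  by move=> a b; under eq_fun do rewrite mxE; exact: KRe.
have kI : entries_in K (fun p => Immx (xi p)).
  by move=> a b; under eq_fun do rewrite mxE; exact: KIm.
by apply: entries_block => //; exact: entriesN.
Qed.

Lemma entries_realify_complexify (H : T -> 'M[R]_n) : entries_in K H ->
  entries_in K (fun p => realify (complexify (H p))).
Proof.
move=> KH; under eq_fun do rewrite realify_complexify.
by apply: entries_block => //; exact: (entries_cst algK).
Qed.

(** [sqrt_closed] concerns symmetric roots, so it is applied to [P] and then to [Q], whose square is
    already known to have entries in [K]; [S] is rational in the two. *)
Lemma entries_realify_S : entries_in K (fun p => realify (Smx (G p) (xi p))).
Proof.
have Kxi := entries_realify_xi.
have KP : entries_in K (fun p => realify (Pmx (G p))).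
  apply: (sqrtK (F := fun p => realify (Pmx (G p))) (M := fun p => realify (complexify (G p)))).
  - by move=> p; have [] := PmxP (pG p).
  - by move=> p; have [_ PP _] := PmxP (pG p); rewrite -realifyM PP.
  - exact: entries_realify_complexify.
have KX : entries_in K (fun p => realify (Xmx (G p) (xi p))).
  rewrite (_ : (fun _ => _) = fun p => realify (Pmx (G p)) *m realify (xi p) *m realify (Pmx (G p))).
    by apply: (entriesM algK) => //; exact: (entriesM algK).
  by apply/funext => p; rewrite /Xmx 2!realifyM.
have KQ : entries_in K (fun p => realify (Qmx (G p) (xi p))).
  apply: (sqrtK (F := fun p => realify (Qmx (G p) (xi p)))
    (M := fun p => 1%:M - realify (Xmx (G p) (xi p)) *m (realify (Xmx (G p) (xi p)))^T)).
  - by move=> p; have [] := QmxP (pG p) (sxi p) (rA p).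
  - move=> p; have [_ QQ _] := QmxP (pG p) (sxi p) (rA p).
    by rewrite -realifyM QQ realifyB realify1 realifyM realify_adj.
  - apply: (entriesB algK); first exact: (entries_cst algK).
    by apply: (entriesM algK) => //; exact: entries_tr.
rewrite (_ : (fun _ => _) = fun p => invmx (realify (Pmx (G p))) *m realify (Qmx (G p) (xi p)) *m realify (Pmx (G p))).
  apply: (entriesM algK) => //; apply: (entriesM algK) => //.
  by apply: (entries_inv algK) => // p; exact/realify_unit/Pmx_unit.
apply/funext => p; have uP := Pmx_unit (pG p).
by rewrite /Smx 2!realifyM (realify_inv uP).
Qed.

Lemma entries_realify_T : entries_in K (fun p => realify (Tmx (G p) (xi p))).
Proof.
have Kxi := entries_realify_xi; have KS := entries_realify_S.
have KcG := entries_realify_complexify KG.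
rewrite (_ : (fun _ => _) = fun p => - 2^-1 *: realify (complexify (invmx (G p))) +
  2^-1 *: invmx (1%:M + realify (Smx (G p) (xi p))) *m
    (realify (xi p) *m realify (complexify (G p)) *m (realify (xi p))^T)); last first.
  by apply/funext => p; exact: realify_Tmx.
apply: (entriesD algK).
  apply: (entriesZ algK); first exact: (alg_cst algK).
  apply: entries_realify_complexify; apply: (entries_inv algK) => // p.
  exact: posdef_unit.
apply: (entriesM algK).
  apply: (entriesZ algK); first exact: (alg_cst algK).
  apply: (entries_inv algK) => [p|]; first exact: unit_one_plus_S.
  by apply: (entriesD algK) => //; exact: (entries_cst algK).
apply: (entriesM algK); last exact: entries_tr.
exact: (entriesM algK).
Qed.

Lemma alg_Re_T a b : K (fun p => complex.Re (Tmx (G p) (xi p) a b)).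
Proof.
have := entries_realify_T (lshift n a) (lshift n b).
by under eq_fun do rewrite /realify block_mxEul mxE.
Qed.

Lemma alg_Im_T a b : K (fun p => complex.Im (Tmx (G p) (xi p) a b)).
Proof.
have := entries_realify_T (lshift n a) (rshift n b).
by under eq_fun do rewrite /realify block_mxEur mxE.
Qed.

End family.

(** * Derivative of the energy density *)

Section trace_identities.
Context {F : fieldType} {n : nat}.
Implicit Types S D W X V G J : 'M[F]_n.

(** With [W = (1 + S)^-1] one has [W S = S W = 1 - W], so the trace of [W (S D + D S)] is
    [2 \tr D - 2 \tr (W D)]. The bracket on the left is the derivative of
    [\tr (1 - S) + ln det (1 + S)], which is thus found without solving for [D]. *)
Lemma mxtrace_sylvester S D DA : 1%:M + S \in unitmx -> S *m D + D *m S = - DA ->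
  2 * (- \tr D + \tr (invmx (1%:M + S) *m D)) = \tr (invmx (1%:M + S) *m DA).
Proof.
move=> uS E; set W := invmx _.
have WS : W *m S = 1%:M - W.
  by rewrite -[S in LHS](addKr 1%:M) mulmxDr mulVmx// mulmxN mulmx1 addrC.
have SW : S *m W = 1%:M - W.
  by rewrite -[S in LHS](addKr 1%:M) mulmxDl mulmxV// mulNmx mul1mx addrC.
have -> : DA = - (S *m D + D *m S) by rewrite E opprK.
rewrite mulmxN mulmxDr linearN linearD /= [W *m (D *m S)]mulmxA.
rewrite [\tr (W *m D *m S)]mxtrace_mulC [W *m (S *m D)]mulmxA [S *m (W *m D)]mulmxA.
by rewrite WS SW mulmxBl mul1mx linearB /=; ring.
Qed.

(** Conjugation by [J] preserves the trace and exchanges [X] with [X^T]. The intertwining relation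
    moves [W] past [X G], and cyclicity matches the two sides. *)
Lemma mxtrace_conj_swap J W X V G : J *m J = 1%:M ->
  J *m X *m J = X^T -> J *m X^T *m J = X -> J *m V *m J = V -> J *m G *m J = G ->
  W *m X *m G = X *m G *m (J *m W *m J) ->
  \tr (W *m (X *m V *m X^T *m G)) = \tr (W *m (X *m G *m X^T *m V)).
Proof.
move=> JJ JX JXT JV JG WX.
have JC A B : J *m (A *m B) *m J = (J *m A *m J) *m (J *m B *m J).
  by rewrite !mulmxA -[J *m A *m J *m J]mulmxA JJ mulmx1.
have -> : \tr (W *m (X *m V *m X^T *m G)) = \tr (J *m (W *m (X *m V *m X^T *m G)) *m J).
  by rewrite [RHS]mxtrace_mulC [J *m (J *m _)]mulmxA JJ mul1mx.
have -> : W *m (X *m G *m X^T *m V) = X *m G *m (J *m W *m J) *m X^T *m V.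
  by rewrite -WX !mulmxA.
rewrite 4!JC JX JV JXT JG; set W' := J *m W *m J.
have -> : W' *m (X^T *m V *m X *m G) = (W' *m X^T *m V) *m (X *m G) by rewrite !mulmxA.
by rewrite mxtrace_mulC !mulmxA.
Qed.

Lemma inv_intertwine J S X G : J *m J = 1%:M -> 1%:M + S \in unitmx ->
  S *m X *m G = X *m G *m (J *m S *m J) ->
  invmx (1%:M + S) *m X *m G = X *m G *m (J *m invmx (1%:M + S) *m J).
Proof.
move=> JJ uS SX; apply: (can_inj (mulKmx uS)).
rewrite -[invmx _ *m X *m G]mulmxA mulKVmx// [RHS]mulmxA.
have -> : (1%:M + S) *m (X *m G) = X *m G *m (J *m (1%:M + S) *m J).
  by rewrite mulmxDl mul1mx [S *m _]mulmxA SX [J *m (1%:M + S)]mulmxDr mulmx1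
      [(J + _) *m J]mulmxDl JJ mulmxDr mulmx1.
rewrite -[X *m G *m _ *m _]mulmxA; have -> : J *m (1%:M + S) *m J *m (J *m invmx (1%:M + S) *m J) = 1%:M.
  rewrite !mulmxA -[_ *m J *m J]mulmxA JJ mulmx1 -[J *m _ *m _]mulmxA mulmxV//.
  by rewrite mulmx1.
by rewrite mulmx1.
Qed.

End trace_identities.

Section density.
Context {R : realType} {n : nat}.
Local Notation C := R[i].

Definition density (G : 'M[R]_n) (xi : 'M[C]_n) : R :=
  - 2^-1 * ln (\det G) + 2^-1 * H_of_sqrt (realify (Smx G xi)).

(* The two summands of the derivative of [xi G conj(xi) G] contribute equally,
   since complex conjugation is the similarity by [conj_sgn]. *)
Lemma mxtrace_realify_swap (G V : 'M[R]_n) (xi : 'M[C]_n) :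
  posdefmx G -> xi^T = xi -> spectral_radius (Amx G xi) < 1 ->
  let W := invmx (1%:M + realify (Smx G xi)) in
  let X := realify xi in let cG := realify (complexify G) in
  let cV := realify (complexify V) in
  \tr (W *m (X *m cV *m X^T *m cG)) = \tr (W *m (X *m cG *m X^T *m cV)).
Proof.
move=> pG sxi rA W X cG cV; pose J := @conj_sgn R n.
have JJ : J *m J = 1%:M := @conj_sgnK R n.
have conjc_complexify (H : 'M[R]_n) : map_mx conjc (complexify H) = complexify H.
  by apply/matrixP => i j; rewrite !mxE /= oppr0.
have JX : J *m X *m J = X^T by rewrite -realify_conj realify_conj_sym.
apply: (mxtrace_conj_swap JJ) => //.
- by rewrite -JX !mulmxA JJ mul1mx -mulmxA JJ mulmx1.
- by rewrite -realify_conj conjc_complexify.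
- by rewrite -realify_conj conjc_complexify.
have uS := unit_one_plus_S pG sxi rA.
have SX : realify (Smx G xi) *m X *m cG = X *m cG *m (J *m realify (Smx G xi) *m J).
  by rewrite -realify_conj -!realifyM (Smx_intertwine pG sxi rA).
exact: (inv_intertwine JJ uS SX).
Qed.

Lemma is_derive_density (G : R -> 'M[R]_n) (xi : 'M[C]_n) (t0 : R) (V : 'M[R]_n) :
  (forall t, posdefmx (G t)) -> xi^T = xi ->
  (forall t, spectral_radius (Amx (G t) xi) < 1) ->
  entries_in (derivable_at (1 : R) t0) G -> derivemx (1 : R) G t0 = V ->
  is_derive t0 (1 : R) (fun t => density (G t) xi) (\tr (Remx (Tmx (G t0) xi) *m V)).
Proof.
move=> pG sxi rA dG GV; have algK := @derivable_at_algebra R R^o 1 t0.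
have sqrtK := @derivable_at_sqrt_closed R R^o 1 t0.
pose S t := realify (Smx (G t) xi); pose X := realify xi.
pose cG t := realify (complexify (G t)); pose cV := realify (complexify V).
have dS : entries_in (derivable_at (1 : R) t0) S.
  by apply: (entries_realify_S algK sqrtK) => // a b; exact: (alg_cst algK).
have dcG : entries_in (derivable_at (1 : R) t0) cG by exact: entries_realify_complexify.
have weak m (F : R -> 'M[R]_m) : entries_in (derivable_at (1 : R) t0) F ->
    entries_in (fun f : R -> R => derivable f t0 1) F.
  by move=> H i j; case: (H i j).
pose DS := derivemx (1 : R) S t0.
have DcG : derivemx (1 : R) cG t0 = cV.
  rewrite /cG /cV !realify_complexify -GV; apply/matrixP => i j.
  rewrite mxE; under eq_fun do rewrite realify_complexify.
  case: (split_ordP i) (split_ordP j) => i' -> [] j' ->.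
  - by rewrite block_mxEul mxE; under eq_fun do rewrite block_mxEul.
  - by rewrite block_mxEur mxE; under eq_fun do rewrite block_mxEur mxE; rewrite derive_cst.
  - by rewrite block_mxEdl mxE; under eq_fun do rewrite block_mxEdl mxE; rewrite derive_cst.
  - by rewrite block_mxEdr mxE; under eq_fun do rewrite block_mxEdr.
have DSE : S t0 *m DS + DS *m S t0 = - (X *m cV *m X^T *m cG t0 + X *m cG t0 *m X^T *m cV).
  rewrite addrC -(derivemxM (weak _ _ dS) (weak _ _ dS)).
  have -> : (fun t => S t *m S t) = fun t => 1%:M + - (X *m cG t *m X^T *m cG t).
    by apply/funext => t; exact: realify_Smx_sqr.
  have cst m (A : 'M[R]_m) : entries_in (derivable_at (1 : R) t0) (fun=> A).
    exact: (entries_cst algK).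
  have d1 : entries_in (derivable_at (1 : R) t0) (fun t => X *m cG t).
    exact: (entriesM algK (cst _ X) dcG).
  have d2 : entries_in (derivable_at (1 : R) t0) (fun t => X *m cG t *m X^T).
    exact: (entriesM algK d1 (cst _ X^T)).
  have d3 : entries_in (derivable_at (1 : R) t0) (fun t => X *m cG t *m X^T *m cG t).
    exact: (entriesM algK d2 dcG).
  rewrite (derivemxD (weak _ _ (cst _ _)) (weak _ _ (entriesN algK d3))) derivemx_cst add0r.
  rewrite (derivemxN (weak _ _ d3)) (derivemxM (weak _ _ d2) (weak _ _ dcG)).
  rewrite (derivemxM (weak _ _ d1) (weak _ _ (cst _ _))).
  by rewrite (derivemxM (weak _ _ (cst _ _)) (weak _ _ dcG)) !derivemx_cst DcG mul0mx add0r mulmx0 addr0.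
have uS := unit_one_plus_S (pG t0) sxi (rA t0).
(* [DS] is eliminated here, and the two traces coming from the product rule are merged into twice
   [tau]. *)
have := mxtrace_sylvester uS DSE; rewrite mulmxDr mxtraceD.
rewrite (mxtrace_realify_swap V (pG t0) sxi (rA t0)) -/X -/(cG t0) -/cV.
set W := invmx (1%:M + S t0); set tau := \tr (W *m (X *m cG t0 *m X^T *m cV)) => DSW.
have dN : entries_in (derivable_at (1 : R) t0) (fun t => 1%:M - S t).
  exact: (entriesB algK (entries_cst algK _) dS).
have dP : entries_in (derivable_at (1 : R) t0) (fun t => 1%:M + S t).
  exact: (entriesD algK (entries_cst algK _) dS).
have dF : entries_in (derivable_at (1 : R) t0) (fun t => 2^-1 *: (1%:M + S t)).
  by apply: (entriesZ algK) => //; exact: (alg_cst algK).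
have d1 := is_derive_trace (weak _ _ dN).
have [detS _] := H_of_sqrtE (pG t0) sxi (rA t0).
have d2 := is_derive_ln_det (weak _ _ dF) detS.
have d3 := is_derive_ln_det (weak _ _ dG) (posdef_det (pG t0)).
have d4 := is_derive_cmul 2^-1 (is_deriveD d1 d2).
have d5 := is_deriveD (is_derive_cmul (- 2^-1) d3) (is_derive_cmul 2^-1 d4).
apply: (is_derive_eq d5); rewrite GV.
have -> : derivemx (1 : R) (fun t => 1%:M - S t) t0 = - DS.
  rewrite (derivemxD (weak _ _ (entries_cst algK _)) (weak _ _ (entriesN algK dS))).
  by rewrite derivemx_cst add0r (derivemxN (weak _ _ dS)).
have -> : derivemx (1 : R) (fun t => 2^-1 *: (1%:M + S t)) t0 = 2^-1 *: DS.
  rewrite (derivemxZ _ (weak _ _ dP)).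
  by rewrite (derivemxD (weak _ _ (entries_cst algK _)) (weak _ _ dS)) derivemx_cst add0r.
have -> : invmx (2^-1 *: (1%:M + S t0)) = 2 *: W.
  rewrite invmxZ ?invrK//.
  by rewrite unitmxE unitfE gt_eqF.
rewrite -scalemxAl -scalemxAr scalerA mulfV ?pnatr_eq0// scale1r.
have -> : \tr (- DS) = - \tr DS by rewrite linearN.
(* Doubling turns the trace of a real part into the trace of a realification, where the formula for
   the moment tensor in terms of [S] is available. *)
apply: (mulfI (_ : 2 != 0 :> R)); first by rewrite pnatr_eq0.
have -> : 2 * \tr (Remx (Tmx (G t0) xi) *m V) = \tr (realify (Tmx (G t0) xi) *m cV).
  rewrite /cV -realifyM mxtrace_realify RemxM.
  have -> : Remx (complexify V) = V by apply/matrixP => i j; rewrite !mxE.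
  have -> : Immx (complexify V) = 0 by apply/matrixP => i j; rewrite !mxE.
  by rewrite mulmx0 subr0.
rewrite (realify_Tmx (pG t0) sxi (rA t0)) mulmxDl mxtraceD.
have E1 : realify (complexify (invmx (G t0))) *m cV = realify (complexify (invmx (G t0) *m V)).
  by rewrite /cV -realifyM complexifyM.
rewrite -!scalemxAl !linearZ /= E1 realify_complexify mxtrace_block.
have -> : \tr (W *m (X *m cG t0 *m X^T) *m cV) = tau by rewrite /tau -!mulmxA.
move: DSW; set x := \tr DS; set y := \tr (W *m DS); set z := \tr (invmx (G t0) *m V).
by move=> DSW; rewrite /GRing.scale /=; lra.
Qed.

Lemma continuous_ln_det (T : topologicalType) m (F : T -> 'M[R]_m) :
  entries_in (fun f : T -> R => continuous f) F ->
  (forall p, 0 < \det (F p)) -> continuous (fun p => ln (\det (F p))).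
Proof.
move=> cF F0 p; apply: (@continuous_comp _ _ _ (fun p => \det (F p)) (@ln R)).
  exact: (alg_det continuous_algebra cF).
exact: continuous_ln.
Qed.

Lemma continuous_H_of_sqrt (T : topologicalType) (G : T -> 'M[R]_n) (xi : T -> 'M[C]_n) :
  (forall p, posdefmx (G p)) -> (forall p, (xi p)^T = xi p) ->
  (forall p, spectral_radius (Amx (G p) (xi p)) < 1) ->
  entries_in (fun f : T -> R => continuous f) G ->
  (forall a b, continuous (fun p => complex.Re (xi p a b))) ->
  (forall a b, continuous (fun p => complex.Im (xi p a b))) ->
  continuous (fun p => H_of_sqrt (realify (Smx (G p) (xi p)))).
Proof.
move=> pG sxi rA cG cRe cIm; have algK := @continuous_algebra R T.
have cS := entries_realify_S algK (@continuous_sqrt_closed R T) pG sxi rA cG cRe cIm.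
apply: (algM algK (alg_cst algK _)); apply: (algD algK).
  apply: (alg_trace algK); exact: (entriesB algK (entries_cst algK _) cS).
apply: continuous_ln_det => [|p]; last by have [] := H_of_sqrtE (pG p) (sxi p) (rA p).
apply: (entriesZ algK (alg_cst algK _)).
exact: (entriesD algK (entries_cst algK _) cS).
Qed.

End density.

(** * First variation and Euler-Lagrange equation *)

Section positivity_is_open.
Context {R : realType}.

Lemma posdef_open (T : topologicalType) m (M : T -> 'M[R]_m) (p0 : T) :
  entries_in (fun f : T -> R => continuous f) M -> (forall p, (M p)^T = M p) ->
  posdefmx (M p0) -> \forall p \near p0, posdefmx (M p).
Proof.
move=> cM sM pM; have [c c0 cM0] := posdef_coercive pM.
(* A perturbation with entries at most [d] changes the form by at most [m d |x|^2]; the denominator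
   [m.+1] makes [m d < c] strict. *)
pose d := c / m.+1%:R; have d0 : 0 < d by rewrite divr_gt0// ltr0n.
have : \forall p \near p0, forall ij : 'I_m * 'I_m, `|M p ij.1 ij.2 - M p0 ij.1 ij.2| < d.
  apply: filter_forall => -[i j] /=.
  have /cvgrPdist_lt/(_ _ d0) := cM i j p0.
  by apply: filterS => p; rewrite distrC.
apply: filterS => p Mp; split=> // x x0.
have xx0 : 0 < (x *m x^T) 0 0.
  by rewrite lt_def dotv_ge0 andbT; apply: contra x0 => /eqP/dotv_eq0 ->.
have dM i j : `|(M p - M p0) i j| <= d by rewrite !mxE; exact/ltW/(Mp (i, j)).
have := sum_mul_le x dM; rewrite mulmxBr mulmxBl.
set a := x *m M p *m x^T; set b := x *m M p0 *m x^T.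
have -> : (a - b) 0 0 = a 0 0 - b 0 0 by rewrite !mxE.
move=> /ler_normlP[h _]; have hb : c * (x *m x^T) 0 0 <= b 0 0 := cM0 x.
have dc : m%:R * d < c.
  by rewrite /d mulrCA -[X in _ < X]mulr1 ltr_pM2l// ltr_pdivrMr ?ltr0n// mul1r ltr_nat.
have := ltr_pM2r xx0 (m%:R * d) c; rewrite dc => h2.
set e := (x *m x^T) 0 0 in h hb h2; set k := m%:R * d in h h2.
by lra.
Qed.

Lemma posdef_near_cube n m (M : 'rV[R]_n * R -> 'M[R]_m) :
  entries_in (fun f : 'rV[R]_n * R -> R => continuous f) M -> (forall p, (M p)^T = M p) ->
  (forall y, posdefmx (M (y, 0))) ->
  \forall t \near (0 : R), forall y, cube y -> posdefmx (M (y, t)).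
Proof.
move=> cM sM pM; have /compact_near_coveringP nc := @compact_cube R n.
apply: (nc R (nbhs (0 : R)) (fun t y => posdefmx (M (y, t)))) => y yc.
have := posdef_open cM sM (pM y).
by apply: filterS => -[z t].
Qed.

Lemma near0_ball (P : R -> Prop) : (\forall t \near (0 : R), P t) ->
  exists2 e : R, 0 < e & forall t, `|t| <= e -> P t.
Proof.
move=> /nbhs_ballP[r /= r0 Pr]; exists (r / 2); first by rewrite divr_gt0.
move=> t tr; apply: Pr; rewrite -ball_normE /ball_ /= sub0r normrN.
by apply: le_lt_trans tr _; rewrite ltr_pdivrMr// ltr_pMr// ltr1n.
Qed.

(* Replacing [t] by [clamp e t] makes a family that is admissible for
   [|t| <= e] admissible for every [t]. *)
Definition clamp (e t : R) : R := Num.max (- e) (Num.min e t).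

Lemma continuous_clamp e : continuous (clamp e).
Proof.
move=> t; apply: (@continuous_max _ _ (cst (- e)) (fun s => Num.min e s)).
  exact: cst_continuous.
apply: (@continuous_min _ _ (cst e) id); first exact: cst_continuous.
exact: cvg_id.
Qed.

Lemma clamp_le e t : 0 <= e -> `|clamp e t| <= e.
Proof.
move=> e0; rewrite ler_norml /clamp; apply/andP; split.
  by rewrite le_max lexx.
by rewrite ge_max ge_min lexx andbT; lra.
Qed.

Lemma clampE e t : `|t| <= e -> clamp e t = t.
Proof.
by rewrite ler_norml => /andP[h1 h2]; rewrite /clamp min_r// max_r.
Qed.

End positivity_is_open.

Lemma trmx_addZ (R : comNzRingType) m (c : R) (A B : 'M[R]_m) :
  A^T = A -> B^T = B -> (A + c *: B)^T = A + c *: B.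
Proof. by move=> sA sB; rewrite linearD linearZ /= sA sB. Qed.

Lemma is_derive_affine (R : realType) (a b t : R) :
  is_derive t (1 : R) (fun s : R => a + s * b) b.
Proof.
rewrite (_ : (fun s => _) = cst a + (fun s : R => b * s)); last first.
  by apply/funext => s; rewrite /= mulrC.
have := is_deriveD (is_derive_cst a t (1 : R)) (is_derive_cmul b (is_derive_id t (1 : R))).
by move=> /is_derive_eq; apply; rewrite add0r mulr1.
Qed.

(** * The energy along a variation *)

Section first_variation.
Context {R : realType} {n : nat}.
Local Notation C := R[i].
Local Notation T := ('rV[R]_n).
Variables (xi : T -> 'M[C]_n) (hxi : higgs_tensor xi).
Variables (u : T -> R) (hu : admissible xi u).
Variables (v : T -> R) (hv : smooth_periodic v).

Let su : smooth u := symplectic_smooth hu.1.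
Let sv : smooth v := hv.1.

Definition Gvar (y : T) (t : R) : 'M[R]_n := hessian u y + t *: hessian v y.

Lemma sym_xi y : (xi y)^T = xi y. Proof. by case: hxi. Qed.

Lemma periodic_hessian_v : Defs.periodic (hessian v).
Proof.
move=> k y; apply/matrixP => a b.
have E z : hessian v z a b = partial b (partial a v) z by rewrite mxE.
exact: (etrans (E _) (etrans (periodic_partial _ (periodic_partial _ hv.2) k y) (esym (E y)))).
Qed.

Lemma Gvar_sym y t : (Gvar y t)^T = Gvar y t.
Proof. exact: (trmx_addZ t (hessian_sym y su) (hessian_sym y sv)). Qed.

Lemma Gvar0 y : Gvar y 0 = hessian u y.
Proof. by rewrite /Gvar scale0r addr0. Qed.

Lemma continuous_Gvar (S : topologicalType) (f : S -> T) (g : S -> R) :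
  continuous f -> continuous g ->
  entries_in (fun h : S -> R => continuous h) (fun s => Gvar (f s) (g s)).
Proof.
move=> cf cg; apply: (entriesD continuous_algebra).
  move=> a b s; apply: (@continuous_comp _ _ _ f (fun y => hessian u y a b)); first exact: cf.
  exact: (smooth_continuous (smooth_hessian su a b)).
apply: (entriesZ continuous_algebra) => // a b s.
apply: (@continuous_comp _ _ _ f (fun y => hessian v y a b)); first exact: cf.
exact: (smooth_continuous (smooth_hessian sv a b)).
Qed.

Lemma continuous_xi (S : topologicalType) (f : S -> T) : continuous f ->
  (forall a b, continuous (fun s => complex.Re (xi (f s) a b))) /\
  (forall a b, continuous (fun s => complex.Im (xi (f s) a b))).
Proof.
move=> cf; have [_ _ sR sI] := hxi; split=> a b s.
  apply: (@continuous_comp _ _ _ f (fun y => complex.Re (xi y a b))); first exact: cf.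
  exact: (smooth_continuous (sR a b)).
apply: (@continuous_comp _ _ _ f (fun y => complex.Im (xi y a b))); first exact: cf.
exact: (smooth_continuous (sI a b)).
Qed.

Definition good_at (y : T) (t : R) : Prop :=
  posdefmx (Gvar y t) /\ spectral_radius (Amx (Gvar y t) (xi y)) < 1.

Lemma realify_Nmx_E (G : 'M[R]_n) (y : T) : realify (Nmx G (xi y)) =
  realify (complexify G) - realify (complexify G) *m realify (xi y) *m
    realify (complexify G) *m (realify (xi y))^T *m realify (complexify G).
Proof. by rewrite /Nmx realifyB 4!realifyM realify_conj_sym// sym_xi. Qed.

Lemma Nmx_sym m (G X : 'M[R]_m) : G^T = G ->
  (G - G *m X *m G *m X^T *m G)^T = G - G *m X *m G *m X^T *m G.
Proof. by move=> sG; rewrite linearB /= !trmx_mul trmxK sG !mulmxA. Qed.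

Lemma near_good_at : \forall t \near (0 : R), forall y, good_at y t.
Proof.
pose S := (T * R)%type.
have c1 : continuous (fun p : S => p.1) by move=> p; exact: cvg_fst.
have c2 : continuous (fun p : S => p.2) by move=> p; exact: cvg_snd.
have cG := continuous_Gvar c1 c2; have [cR cI] := continuous_xi c1.
have algK := @continuous_algebra R S.
have cxi := entries_realify_xi algK cR cI.
have ccG := entries_realify_complexify algK cG.
have n1 : \forall t \near (0 : R), forall y, cube y -> posdefmx (Gvar y t).
  apply: (posdef_near_cube (M := fun p => Gvar p.1 p.2)) => // [p|y].
    exact: Gvar_sym.
  by rewrite Gvar0; exact: hu.1.2.
have n2 : \forall t \near (0 : R), forall y, cube y -> posdefmx (realify (Nmx (Gvar y t) (xi y))).
  apply: (posdef_near_cube (M := fun p => realify (Nmx (Gvar p.1 p.2) (xi p.1)))).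
  - rewrite (_ : (fun p : S => _) = fun p => realify (complexify (Gvar p.1 p.2)) -
      realify (complexify (Gvar p.1 p.2)) *m realify (xi p.1) *m
      realify (complexify (Gvar p.1 p.2)) *m (realify (xi p.1))^T *m
      realify (complexify (Gvar p.1 p.2))).
      apply: (entriesB algK ccG); apply: (entriesM algK _ ccG).
      apply: (entriesM algK _ (entries_tr cxi)); apply: (entriesM algK _ ccG).
      exact: (entriesM algK ccG cxi).
    by apply/funext => p; exact: realify_Nmx_E.
  - move=> p; rewrite realify_Nmx_E; apply: Nmx_sym.
    by rewrite realify_complexify tr_block_mx Gvar_sym !trmx0.
  - move=> y; rewrite Gvar0 -(spectral_radius_posdef (hu.1.2 y) (sym_xi y)).
    exact: hu.2.
(* Both conditions pass from the cube to all points because the Hessians and [xi] are invariant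
   under integer translations, even though [u] is not. *)
apply: filterS2 n1 n2 => t h1 h2 y; have [k yk] := periodic_reduce y.
have GE : Gvar y t = Gvar (y + map_mx intr k) t.
  by rewrite /Gvar (hessian_periodic hu.1 k) (periodic_hessian_v k).
have xE : xi y = xi (y + map_mx intr k) by case: hxi => /(_ k y).
rewrite /good_at GE xE; have p1 := h1 _ yk; split; first exact: p1.
exact: (proj2 (spectral_radius_posdef p1 (sym_xi _)) (h2 _ yk)).
Qed.

Lemma hessian_varyE t y : hessian (vary u v t) y = Gvar y t.
Proof. exact: hessian_vary. Qed.

Lemma admissible_vary t : (forall y, good_at y t) -> admissible xi (vary u v t).
Proof.
move=> gt; have [[[f [sf pf] uE] _] _] := hu; split.
  split; last by move=> y; rewrite hessian_varyE; exact: (gt y).1.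
  exists (fun y => f y + t * v y).
    split.
      apply: (algD smooth_algebra sf); apply: (algM smooth_algebra _ sv).
      exact: (alg_cst smooth_algebra).
    by move=> k y; rewrite pf hv.2.
  by move=> y; rewrite /vary uE addrA.
move=> y; rewrite /xiGxiG /xiGxi hessian_varyE; exact: (gt y).2.
Qed.

Lemma near_admissible : \forall t \near (0 : R), admissible xi (vary u v t).
Proof. by apply: filterS near_good_at => t; exact: admissible_vary. Qed.

Lemma HK_energy_vary t : (forall y, good_at y t) ->
  HK_energy xi (vary u v t) = torus_integral (fun y => density (Gvar y t) (xi y)).
Proof.
move=> gt; have cid : continuous (fun y : T => y) by move=> y; exact: cvg_id.
have cst : continuous (fun _ : T => t) by exact: cst_continuous.
have cG := continuous_Gvar cid cst; have [cR cI] := continuous_xi cid.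
have pG y := (gt y).1; have rA y := (gt y).2.
have cd := continuous_ln_det cG (fun y => posdef_det (pG y)).
have cH := continuous_H_of_sqrt pG sym_xi rA cG cR cI.
have e1 : (fun y => ln (\det (hessian (vary u v t) y))) = fun y => ln (\det (Gvar y t)).
  by apply/funext => y; rewrite hessian_varyE.
have e2 : HK_H (vary u v t) xi = fun y => H_of_sqrt (realify (Smx (Gvar y t) (xi y))).
  apply/funext => y; have [_ <-] := H_of_sqrtE (pG y) (sym_xi y) (rA y).
  by rewrite /HK_H /xiGxiG /xiGxi hessian_varyE.
rewrite /HK_energy e1 e2.
rewrite -(torus_integralZ _ cd) -(torus_integralZ _ cH) -torus_integralD//.
  exact: (algM continuous_algebra (alg_cst continuous_algebra _) cd).
exact: (algM continuous_algebra (alg_cst continuous_algebra _) cH).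
Qed.

(** The derivative in [t] of the energy density at [y]: the real part of the moment tensor of the
    varied potential paired with the Hessian of [v]. *)
Definition dGvar (y : T) (t : R) : R :=
  \tr (Remx (Tmx (Gvar y t) (xi y)) *m hessian v y).

Section clamped.
Variable e : R.
Hypothesis e0 : 0 < e.
Hypothesis ge : forall t, `|t| <= e -> forall y, good_at y t.

Let good_at_clamp y t : good_at y (clamp e t).
Proof. by apply: ge; apply: clamp_le; exact: ltW. Qed.

Lemma derivable_density_at y t : `|t| < e ->
  is_derive t (1 : R) (fun t => density (Gvar y t) (xi y)) (dGvar y t).
Proof.
move=> te.
(* Strictness of [|t| < e] makes truncation invisible near [t], so derivatives of the truncated
   family are those of the original one. *)
have nt : \forall s \near t, clamp e s = s.
  have te' : t \in `]- e, e[ by rewrite in_itv /= -ltr_norml.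
  apply: filterS (near_in_itvoo te') => s; rewrite in_itv /= -ltr_norml => se.
  by rewrite clampE// ltW.
have dG a b : derivable (fun s => Gvar y (clamp e s) a b) t 1 /\
    'D_1 (fun s => Gvar y (clamp e s) a b) t = hessian v y a b.
  have H : is_derive t (1 : R) (fun s : R => hessian u y a b + s * hessian v y a b) (hessian v y a b).
    exact: is_derive_affine.
  have GE s : Gvar y s a b = hessian u y a b + s * hessian v y a b.
    by rewrite [LHS]mxE [X in _ + X]mxE.
  suff [] : is_derive t (1 : R) (fun s => Gvar y (clamp e s) a b) (hessian v y a b) by [].
  apply: near_eq_is_derive H; apply: filterS nt => s se.
  exact: (etrans (esym (GE s)) (congr1 (fun r => Gvar y r a b) (esym se))).
have cG := continuous_Gvar (fun z => @cst_continuous R T y z) (@continuous_clamp R e).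
have dGe : entries_in (derivable_at (1 : R) t) (fun s => Gvar y (clamp e s)).
  by move=> a b; split; [exact: cG|exact: (dG a b).1].
have DG : derivemx (1 : R) (fun s => Gvar y (clamp e s)) t = hessian v y.
  by apply/matrixP => a b; rewrite mxE (dG a b).2.
have H := @is_derive_density R n (fun s => Gvar y (clamp e s)) (xi y) t (hessian v y)
  (fun s => (good_at_clamp y s).1) (sym_xi y) (fun s => (good_at_clamp y s).2) dGe DG.
rewrite /= (clampE (ltW te)) in H.
apply: near_eq_is_derive H.
apply: filterS nt => s se; exact: (congr1 (fun r => density (Gvar y r) (xi y)) se).
Qed.

(** With [t] truncated, the function is continuous on all of [T * R], hence bounded on the compact
    set [cube * [-e, e]]. The bound supplies the domination for differentiating under the
    integral. *)
Lemma dGvar_bounded : exists M, forall y t, cube y -> `|t| < e -> `|dGvar y t| <= M.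
Proof.
pose S := (T * R)%type.
have c1 : continuous (fun p : S => p.1) by move=> p; exact: cvg_fst.
have c2 : continuous (fun p : S => clamp e p.2).
  move=> p; apply: (@continuous_comp _ _ _ (fun p : S => p.2) (clamp e)); first exact: cvg_snd.
  exact: continuous_clamp.
have cG := continuous_Gvar c1 c2; have [cR cI] := continuous_xi c1.
have algK := @continuous_algebra R S.
have cT := alg_Re_T algK (@continuous_sqrt_closed R S) (fun p => (good_at_clamp p.1 p.2).1)
  (fun p => sym_xi p.1) (fun p => (good_at_clamp p.1 p.2).2) cG cR cI.
have cd : continuous (fun p : S => dGvar p.1 (clamp e p.2)).
  apply: (alg_trace algK (F := fun p : S =>
    Remx (Tmx (Gvar p.1 (clamp e p.2)) (xi p.1)) *m hessian v p.1)).
  apply: (entriesM algK).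
    by move=> a b; under eq_fun do rewrite mxE; exact: cT.
  move=> a b p; apply: (@continuous_comp _ _ _ (fun p : S => p.1) (fun y => hessian v y a b)).
    exact: c1.
  exact: (smooth_continuous (smooth_hessian sv a b)).
have cK : compact (@cube R n `*` `[- e, e]%classic).
  by apply: compact_setX; [exact: compact_cube|exact: segment_compact].
have [M HM] := continuous_bounded_on cd cK; exists M => y t yc te.
have te' : `|t| <= e by exact: ltW.
by have := HM (y, t); rewrite /= clampE//; apply; split=> //=; rewrite in_itv /= -ler_norml.
Qed.

Lemma is_derive_HK_energy : is_derive (0 : R) (1 : R)
  (fun t => HK_energy xi (vary u v t)) (torus_integral (fun y => dGvar y 0)).
Proof.
pose f (t : R) (s : n.-tuple (measurableTypeR R)) := density (Gvar (row_of s) t) (xi (row_of s)).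
have I0 : `]- e, e[%classic (0 : R) by rewrite /= in_itv /= oppr_lt0 e0.
have Ie t : `]- e, e[%classic t -> `|t| < e by rewrite /= in_itv /= -ltr_norml.
have mC := @measurable_unit_cube R n.
have intf t : `]- e, e[%classic t -> (lebesgue_tuple n).-integrable unit_cube (EFin \o f t).
  move=> /Ie te; have gt := ge (ltW te).
  have cid : continuous (fun y : T => y) by move=> y; exact: cvg_id.
  have cst : continuous (fun _ : T => t) by exact: cst_continuous.
  have cG := continuous_Gvar cid cst; have [cR cI] := continuous_xi cid.
  apply: (@integrable_cube R n (fun y => density (Gvar y t) (xi y))).
  have pG y := (gt y).1; have rA y := (gt y).2.
  have cd := continuous_ln_det cG (fun y => posdef_det (pG y)).
  have cH := continuous_H_of_sqrt pG sym_xi rA cG cR cI.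
  have algK := @continuous_algebra R T.
  exact: (algD algK (algM algK (alg_cst algK _) cd) (algM algK (alg_cst algK _) cH)).
have df t s : `]- e, e[%classic t -> is_derive t (1 : R) (f^~ s) (dGvar (row_of s) t).
  by move=> /Ie te; exact: derivable_density_at.
have [M HM] := dGvar_bounded.
(* The dominating constant has to be nonnegative, which [|M|] is by construction. *)
have M0 : 0 <= `|M| by [].
have intM : (lebesgue_tuple n).-integrable unit_cube (EFin \o (fun _ : n.-tuple (measurableTypeR R) => `|M|)).
  exact: (@integrable_cube R n (fun=> `|M|) (fun y => @cst_continuous _ _ _ y)).
have p1E t s : `]- e, e[%classic t -> partial1of2 f t s = dGvar (row_of s) t.
  by move=> te; rewrite partial1of2E; exact: (@derive_val _ _ _ _ _ _ _ (df t s te)).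
have bnd t s : `]- e, e[%classic t -> unit_cube s -> `|partial1of2 f t s| <= `|M|.
  move=> te sc; rewrite (p1E _ _ te); apply: le_trans (ler_norm M).
  by apply: HM; [exact: row_of_cube|exact: Ie].
have dfd t s (te : `]- e, e[%classic t) (_ : unit_cube s) : derivable (f^~ s) t 1 :=
  @ex_derive _ _ _ _ _ _ _ (df t s te).
have D1 := @derivable_under_integral R _ _ (lebesgue_tuple n) f unit_cube mC 0 (- e) e I0 intf dfd
  (fun=> `|M|) (fun=> M0) intM bnd.
have D2 := @differentiation_under_integral R _ _ (lebesgue_tuple n) f unit_cube mC 0 (- e) e I0 intf dfd
  (fun=> `|M|) (fun=> M0) intM bnd.
apply: (@near_eq_is_derive _ _ _ (fun t => torus_integral (fun y => density (Gvar y t) (xi y)))).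
  have te' : (0 : R) \in `]- e, e[ by rewrite in_itv /= oppr_lt0 e0.
  apply: filterS (near_in_itvoo te') => t; rewrite in_itv /= -ltr_norml => te.
  by rewrite HK_energy_vary//; exact/ge/ltW.
split; first exact: D1.
rewrite -derive1E; apply: (etrans D2); apply: eq_Rintegral => s _.
exact: p1E.
Qed.
End clamped.

Lemma HK_energy_first_variation :
  has_first_variation (HK_energy xi) u v /\
  first_variation (HK_energy xi) u v = torus_integral (fun y => dGvar y 0).
Proof.
have [e e0 ge] := near0_ball near_good_at.
by have [d1 d2] := is_derive_HK_energy e0 ge.
Qed.

End first_variation.

(** * From the first variation to the moment map equation *)

Section euler_lagrange.
Context {R : realType} {n : nat}.
Local Notation C := R[i].
Local Notation T := ('rV[R]_n).
Variables (xi : T -> 'M[C]_n) (hxi : higgs_tensor xi).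
Variables (u : T -> R) (hu : admissible xi u).

Definition ReT (a b : 'I_n) (y : T) : R := complex.Re (Tmx (hessian u y) (xi y) a b).
Definition ImT (a b : 'I_n) (y : T) : R := complex.Im (Tmx (hessian u y) (xi y) a b).

Definition double_div (y : T) : R := \sum_a \sum_b partial b (partial a (ReT a b)) y.

Let su : smooth u := symplectic_smooth hu.1.

Lemma smooth_moment : (forall a b, smooth (ReT a b)) /\ (forall a b, smooth (ImT a b)).
Proof.
have [_ sx sR sI] := hxi; have algK := @smooth_algebra R n.
have sq := @smooth_sqrt_closed R n; have sH := smooth_hessian su.
split=> a b.
  exact: (alg_Re_T algK sq hu.1.2 sx hu.2 sH sR sI).
exact: (alg_Im_T algK sq hu.1.2 sx hu.2 sH sR sI).
Qed.

Lemma periodic_ReT a b : Defs.periodic (ReT a b).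
Proof.
have [px _ _ _] := hxi; move=> k y.
by rewrite /ReT (hessian_periodic hu.1 k y) (px k y).
Qed.

Lemma ImT_antisym a b : ImT b a = fun y => -1 * ImT a b y.
Proof.
apply/funext => y; have := realify_Tmx_sym (hu.1.2 y) (sym_xi hxi y) (hu.2 y).
move=> /(congr1 (fun M : 'M[R]_(n + n) => M (lshift n a) (rshift n b))).
rewrite /realify [X in X = _]mxE block_mxEdl block_mxEur => H.
by rewrite mulN1r /ImT; move: H; rewrite [LHS]mxE [X in - X]mxE [RHS]mxE => <-; rewrite opprK.
Qed.

(** Relabelling the indices and commuting the two partial derivatives turns the sum into its
    opposite. *)
Lemma sum_partial2_ImT y : \sum_a \sum_b partial b (partial a (ImT a b)) y = 0.
Proof.
have [_ sI] := smooth_moment; set X := LHS.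
have scst c : smooth (fun _ : T => c : R) by exact: (alg_cst smooth_algebra).
have pN i (f : T -> R) : smooth f -> partial i (fun x => -1 * f x) = fun x => -1 * partial i f x.
  move=> sf; rewrite (partialM i (scst _) sf); apply/funext => x.
  by rewrite partial_cst mul0r add0r.
have : X = - X.
  rewrite {1}/X exchange_big /= /X -sumrN; apply: eq_bigr => a _.
  rewrite -sumrN; apply: eq_bigr => b _.
  rewrite (ImT_antisym a b) (pN _ _ (sI a b)) (pN _ _ (smooth_partial _ (sI a b))) mulN1r.
  by rewrite (partialC _ _ (sI a b)).
by move=> /eqP; rewrite -addr_eq0 -mulr2n mulrn_eq0 /= => /eqP.
Qed.

Lemma real_moment_map_eqE : real_moment_map_eq xi u <-> forall y, double_div y = 0.
Proof.
have E y : \sum_a \sum_b cpartial b (cpartial a (fun x => moment_tensor u xi x a b)) y =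
    Complex (double_div y) 0.
  rewrite -(sum_partial2_ImT y) /double_div.
  have cE (I : finType) (F : I -> C) : \sum_i F i =
      Complex (\sum_i complex.Re (F i)) (\sum_i complex.Im (F i)).
    by rewrite -Re_sum -Im_sum; case: (\sum_i F i).
  rewrite cE; congr Complex; apply: eq_bigr => a _; rewrite ?Re_sum ?Im_sum; exact: eq_bigr.
split=> H y; have := H y; first by rewrite E => -[].
by rewrite E => ->.
Qed.

Lemma smooth_periodic_double_div : smooth_periodic double_div.
Proof.
have [sR _] := smooth_moment; split.
  apply: (alg_sum smooth_algebra) => a; apply: (alg_sum smooth_algebra) => b.
  by do 2!apply: smooth_partial; exact: sR.
move=> k y; rewrite /double_div; apply: eq_bigr => a _; apply: eq_bigr => b _.
exact: (periodic_partial _ (periodic_partial _ (@periodic_ReT a b))).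
Qed.

Lemma first_variationE v : smooth_periodic v ->
  torus_integral (fun y => dGvar xi u v y 0) = torus_integral (fun y => double_div y * v y).
Proof.
move=> hv; have [sv pv] := hv; have [sR _] := smooth_moment.
have sM f g : smooth f -> smooth g -> continuous (fun y : T => f y * g y).
  by move=> sf sg; apply: smooth_continuous; exact: (algM smooth_algebra).
have cs I (r : seq I) (f : I -> T -> R) : (forall i, continuous (f i)) ->
    continuous (fun y => \sum_(i <- r) f i y).
  by move=> cf; exact: (alg_sum continuous_algebra).
(* The trace pairs the entry [a b] of the tensor with the entry [b a] of the Hessian, that is
   [partial a (partial b v)]. Integrating by parts in [a] and then in [b] yields the order of
   derivatives used in [double_div]. *)
have -> : (fun y => dGvar xi u v y 0) =
    fun y => \sum_a \sum_b ReT a b y * partial a (partial b v) y.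
  apply/funext => y; rewrite /dGvar Gvar0; apply: eq_bigr => a _.
  rewrite [LHS]mxE; apply: eq_bigr => b _; rewrite [X in X * _]mxE [X in _ * X]mxE.
  by [].
have -> : (fun y => double_div y * v y) =
    fun y => \sum_a \sum_b partial b (partial a (ReT a b)) y * v y.
  by apply/funext => y; rewrite /double_div mulr_suml; apply: eq_bigr => a _; rewrite mulr_suml.
have spv i : smooth_periodic (partial i v).
  by split; [exact: smooth_partial|exact: periodic_partial].
have spR a b : smooth_periodic (ReT a b) by split; [exact: sR|exact: periodic_ReT].
have spdR a b : smooth_periodic (partial a (ReT a b)).
  by split; [exact/smooth_partial/sR|exact/periodic_partial/periodic_ReT].
have c1 a b : continuous (fun y => ReT a b y * partial a (partial b v) y).
  exact: (sM _ _ (sR a b) (smooth_partial a (smooth_partial b sv))).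
have c2 a b : continuous (fun y => partial b (partial a (ReT a b)) y * v y).
  exact: (sM _ _ (smooth_partial b (smooth_partial a (sR a b))) sv).
rewrite (torus_integral_sum _ (fun a => cs _ _ _ (c1 a))).
rewrite (torus_integral_sum _ (fun a => cs _ _ _ (c2 a))).
apply: eq_bigr => a _.
rewrite (torus_integral_sum _ (c1 a)) (torus_integral_sum _ (c2 a)).
apply: eq_bigr => b _.
rewrite (torus_integral_by_parts a (spR a b) (spv b)).
by rewrite (torus_integral_by_parts b (spdR a b) hv) opprK.
Qed.

End euler_lagrange.

Theorem proposition4p0p4 (R : realType) (n : nat)
  (xi : 'rV[R]_n -> 'M[R[i]]_n) (hxi : higgs_tensor xi)
  (u : 'rV[R]_n -> R) (hu : admissible xi u) :
  (forall v : 'rV[R]_n -> R, smooth_periodic v ->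
     (\forall t \near (0 : R), admissible xi (vary u v t)) /\
     has_first_variation (HK_energy xi) u v) /\
  (real_moment_map_eq xi u <-> critical_point (HK_energy xi) u).
Proof.
split=> [v hv|].
  split; first exact: near_admissible.
  exact: (HK_energy_first_variation hxi hu hv).1.
have varE v (hv : smooth_periodic v) : first_variation (HK_energy xi) u v =
    torus_integral (fun y => double_div xi u y * v y).
  by rewrite (HK_energy_first_variation hxi hu hv).2 (first_variationE hxi hu hv).
rewrite (real_moment_map_eqE hxi hu); split=> [div0 v hv|crit].
  split; first exact: (HK_energy_first_variation hxi hu hv).1.
  rewrite (varE v hv) (_ : (fun y => _) = fun y => 0 * double_div xi u y).
    rewrite torus_integralZ ?mul0r//; apply: smooth_continuous.
    exact: (smooth_periodic_double_div hxi hu).1.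
  by apply/funext => y; rewrite div0 !mul0r.
have hE := smooth_periodic_double_div hxi hu; apply: (periodic_cube hE.2).
apply: torus_integral_sqr_eq0; first exact: (smooth_continuous hE.1).
by rewrite -(varE _ hE); exact: (crit _ hE).2.
Qed.
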